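(* Let $\Omega\subseteq\mathbb H^n$ be a domain, $1\le m\le n$, and $B(a,R)\Subset\Omega$ for some $a\in\Omega$, $R>0$. For $u\in QSH_m(\Omega)$ and $0<r<R$ put $$\sigma(a,r)=\int_{B(a,r)}\Delta u\wedge\beta_n^{n-1}.$$ Then $\dfrac{\sigma(a,r)}{r^{\frac{4n(m-1)}{m}}}$ is an increasing (nondecreasing) function of $r$ for $0<r<R$, and the limit $$v_a(u)=\lim_{r\to0}\frac{\sigma(a,r)}{r^{\frac{4n(m-1)}{m}}}$$ exists and is nonnegative.
   Context: Coordinates: $q=(q_0,\dots,q_{n-1})\in\mathbb H^n\cong\mathbb R^{4n}$, $q_l=x_{4l}+x_{4l+1}\mathbf i+x_{4l+2}\mathbf j+x_{4l+3}\mathbf k$; $dV$ is Lebesgue measure; $B(a,r)$ is the Euclidean ball. Forms: fix a basis $\omega^0,\dots,\omega^{2n-1}$ of $\mathbb C^{2n}$. For $l=0,\dots,n-1$ let $\nabla_{l0}=\partial_{x_{4l}}+\mathbf i\partial_{x_{4l+1}}$, $\nabla_{l1}=-\partial_{x_{4l+2}}-\mathbf i\partial_{x_{4l+3}}$, $\nabla_{(n+l)0}=\partial_{x_{4l+2}}-\mathbf i\partial_{x_{4l+3}}$, $\nabla_{(n+l)1}=\partial_{x_{4l}}-\mathbf i\partial_{x_{4l+1}}$ (complex $\mathbf i$). For a $\wedge^p\mathbb C^{2n}$-valued $F=\sum_If_I\omega^I$ put $d_\alpha F=\sum_I\sum_{A=0}^{2n-1}\nabla_{A\alpha}f_I\,\omega^A\wedge\omega^I$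 ($\alpha=0,1$) and $\Delta=d_0d_1$. Let $\beta_n=\sum_{l=0}^{n-1}\omega^l\wedge\omega^{n+l}$, $\Omega_{2n}=\omega^0\wedge\omega^n\wedge\cdots\wedge\omega^{n-1}\wedge\omega^{2n-1}$, and $\int f\,\Omega_{2n}=\int f\,dV$. Class $QSH_m$: $\frac{\partial}{\partial\overline{q_l}}=\partial_{x_{4l}}+\mathbf i\partial_{x_{4l+1}}+\mathbf j\partial_{x_{4l+2}}+\mathbf k\partial_{x_{4l+3}}$, and $\frac{\partial}{\partial q_l}$ is its conjugate. For a hyperhermitian matrix $A=U\operatorname{diag}(\lambda_1,\dots,\lambda_n)U^*$ ($U$ quaternionic unitary, $\lambda_j\in\mathbb R$) put $\mathcal H_m(A)=\sum_{j_1<\dots<j_m}\lambda_{j_1}\cdots\lambda_{j_m}$; $\Gamma_m$ is the set of hyperhermitian $A$ with $\mathcal H_m(sI+A)>0$ for all $s\ge0$. A real $C^2$ function $v$ is quaternionic $m$-subharmonic if $\left(\frac{\partial^2v}{\partial\overline{q_l}\partial q_k}\right)(q)\in\overline\Gamma_m$ for all $q$. $QSH_m(\Omega)$ is the set of $[-\infty,\infty)$-valued upper semicontinuous $u\in L^1_{loc}(\Omega)$ such that $\int_\Omega u\,\Delta v_1\wedge\dots\wedge\Delta v_{m-1}\wedge\beta_n^{n-m}\wedge\Delta\omega\ge0$ for all $C^4$ quaternionic $m$-subharmonic $v_1,\dots,v_{m-1}$ on $\Omega$ and all $0\le\omega\in C_0^\infty(\Omega)$. For $u\in QSH_m(\Omega)$,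 $\Delta u\wedge\beta_n^{n-1}$ is the nonnegative Radon measure on $\Omega$ determined by $\Delta u\wedge\beta_n^{n-1}(\omega)=\int_\Omega u\,\beta_n^{n-1}\wedge\Delta\omega$ for $\omega\in C_0^\infty(\Omega)$. The number $v_a(u)$ is called the $m$-Lelong number of $u$ at $a$. *)

(* Defs.v *)
From HB Require Import structures.
From mathcomp Require Import all_boot all_order all_algebra.
From mathcomp Require Import all_classical all_reals all_analysis.
From mathcomp Require Import ring lra complex.
Set Implicit Arguments.
Unset Strict Implicit.
Unset Printing Implicit Defensive.

Import Order.TTheory GRing.Theory Num.Theory.
Import numFieldNormedType.Exports.

Local Open Scope classical_set_scope.
Local Open Scope ring_scope.
Local Open Scope complex_scope.

(* A point q = (q_0, ..., q_(n-1)) of H^n ~ R^(4n) is the n x 4 real matrix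
   whose row l is (x_(4l), x_(4l+1), x_(4l+2), x_(4l+3)). *)
Notation Hn R n := 'M[R]_(n, 4).

Definition borel (R : realType) (n : nat) : Type :=
  g_sigma_algebraType (@open (Hn R n)).

HB.instance Definition _ R n :=
  Measurable.copy (borel R n) (g_sigma_algebraType (@open (Hn R n))).

Lemma product_sigma_finite d1 d2 (T1 : measurableType d1)
    (T2 : measurableType d2) (R : realType)
    (m1 : {sigma_finite_measure set T1 -> \bar R})
    (m2 : {sigma_finite_measure set T2 -> \bar R}) :
  sigma_finite setT (m1 \x m2)%E.
Proof.
have /sigma_finiteP[F [TF ndF Foo]] := sigma_finiteT m1.
have /sigma_finiteP[G [TG ndG Goo]] := sigma_finiteT m2.
exists (fun k => F k `*` G k).
  rewrite -setXTT TF TG predeqE => -[x y]; split.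
    move=> [/= [k _ Fkx] [l _ Gly]]; exists (maxn k l) => //; split.
    - by move: x Fkx; exact/subsetPset/ndF/leq_maxl.
    - by move: y Gly; exact/subsetPset/ndG/leq_maxr.
  by move=> [k _ []/= ? ?]; split; exists k.
move=> k; have [mF Fk] := Foo k; have [mG Gk] := Goo k.
split; first exact: measurableX.
by rewrite product_measure1E// lte_mul_pinfty// ge0_fin_numE.
Qed.

Section tuple_lebesgue.
Context {R : realType}.
Local Open Scope ereal_scope.
Local Notation T := (measurableTypeR R).

Section step.
Variables (k : nat) (m : {sigma_finite_measure set (k.-tuple T) -> \bar R}).

Definition cons_pair (p : T * k.-tuple T) : k.+1.-tuple T :=
  [tuple of p.1 :: p.2].

Lemma measurable_cons_pair : measurable_fun setT cons_pair.
Proof. exact: measurable_cons. Qed.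

Definition lebesgue_cons : set (k.+1.-tuple T) -> \bar R :=
  pushforward (lebesgue_measure \x m) cons_pair.

Lemma lebesgue_cons0 : lebesgue_cons set0 = 0.
Proof. by rewrite /lebesgue_cons /pushforward preimage_set0 measure0. Qed.

Lemma lebesgue_cons_ge0 A : 0 <= lebesgue_cons A.
Proof. by rewrite /lebesgue_cons /pushforward. Qed.

Lemma lebesgue_cons_sigma_additive : semi_sigma_additive lebesgue_cons.
Proof.
move=> F mF tF mUF; rewrite /lebesgue_cons /pushforward preimage_bigcup.
have mpre A : measurable A -> measurable (cons_pair @^-1` A).
  by move=> mA; rewrite -[X in measurable X]setTI; exact: measurable_cons_pair.
apply: measure_semi_sigma_additive.
- by move=> i; exact: mpre.
- apply/trivIsetP => /= i j _ _ ij; rewrite -preimage_setI.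
  by move/trivIsetP : tF => /(_ _ _ _ _ ij) ->//; rewrite preimage_set0.
- by rewrite -preimage_bigcup; exact: mpre.
Qed.

HB.instance Definition _ := isMeasure.Build _ _ _ lebesgue_cons
  lebesgue_cons0 lebesgue_cons_ge0 lebesgue_cons_sigma_additive.

Lemma lebesgue_cons_sigma_finite : sigma_finite setT lebesgue_cons.
Proof.
have [F FT Foo] := product_sigma_finite lebesgue_measure m.
pose g (t : k.+1.-tuple T) : T * k.-tuple T := (thead t, [tuple of behead t]).
have gK p : g (cons_pair p) = p.
  by case: p => x t; rewrite /g /cons_pair/= theadE; congr pair; exact/val_inj.
have mg : measurable_fun setT g.
  apply: measurable_fun_pair => /=; last exact: measurable_behead.
  exact: measurable_tnth.
exists (fun i => g @^-1` F i).
  by rewrite -preimage_bigcup -FT preimage_setT.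
move=> i; have [mFi Fioo] := Foo i; split.
  by rewrite -[X in measurable X]setTI; exact: mg.
rewrite /lebesgue_cons /pushforward -comp_preimage.
rewrite (_ : g \o cons_pair = id) ?preimage_id//.
by apply/funext => p /=; exact: gK.
Qed.

HB.instance Definition _ := Measure_isSigmaFinite.Build _ _ _ lebesgue_cons
  lebesgue_cons_sigma_finite.

End step.

Definition lebesgue_nil : set (0.-tuple T) -> \bar R := dirac [tuple].
HB.instance Definition _ := SigmaFiniteMeasure.on lebesgue_nil.

Fixpoint lebesgue_tuple (k : nat) :
    {sigma_finite_measure set (k.-tuple T) -> \bar R} :=
  if k is k'.+1 then lebesgue_cons (lebesgue_tuple k') else lebesgue_nil.

End tuple_lebesgue.

Section lebesgue_space.
Context {R : realType} {n : nat}.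
Local Notation T := (measurableTypeR R).

(* x_0, ..., x_(4n-1) |-> q : row-major, so that the (l, j) entry is x_(4l+j) *)
Definition point_of_tuple (t : (n * 4).-tuple T) : borel R n :=
  vec_mx (\row_k (tnth t k : R)).

Definition box (c : 'M[rat]_(n, 4)) (k : nat) : set (Hn R n) :=
  [set x | forall l j, `|ratr (c l j) - x l j| < k.+1%:R^-1].

Lemma open_boxes (U : set (Hn R n)) : open U ->
  U = \bigcup_(ck in [set ck : 'M[rat]_(n, 4) * nat | box ck.1 ck.2 `<=` U])
        box ck.1 ck.2.
Proof.
move=> oU; apply/seteqP; split=> [x Ux|x [[c k] /= + bx]]; last exact.
have /nbhs_ballP[_/posnumP[e] eU] : nbhs x U by exact: open_nbhs_nbhs.
pose k := Num.truncn (2 / e%:num).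
have ke : k.+1%:R^-1 < e%:num / 2.
  by rewrite -[ltRHS]invf_div ltf_pV2 ?posrE// truncnS_gt.
have /choice[f fx] : forall lj : 'I_n * 'I_4, exists q : rat,
    `|ratr q - x lj.1 lj.2| < k.+1%:R^-1.
  move=> [l j] /=.
  have /rat_in_itvoo[q /itvP qx] : x l j < x l j + k.+1%:R^-1 :> R.
    by rewrite ltrDl invr_gt0.
  by exists q; rewrite ltr_distl (lt_trans _ (_ : x l j < _)) ?qx// ltrBlDl ltrDr.
exists (\matrix_(l, j) f (l, j), k) => /=; last by move=> l j; rewrite mxE; exact: fx.
move=> y by_; apply: eU; split => // l j; rewrite /ball /=.
have := by_ l j; have := fx (l, j); rewrite mxE/= => h1 h2.
rewrite (le_lt_trans (ler_distD (ratr (f (l, j))) _ _))// (splitr e%:num).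
by rewrite ltrD// (lt_trans _ ke)// distrC.
Qed.

Lemma measurable_point_of_tuple : measurable_fun setT point_of_tuple.
Proof.
apply: (@measurability _ _ _ _ _ _ (@open (Hn R n) : set (set (borel R n)))) => //.
move=> _ [U oU <-]; rewrite setTI (open_boxes oU) preimage_bigcup bigcup_mkcond.
apply: countable_bigcupT_measurable => // -[c k]; case: ifPn => // _.
rewrite (_ : _ @^-1` _ = \big[setI/setT]_(lj : 'I_n * 'I_4)
    ((@tnth _ T ^~ (mxvec_index lj.1 lj.2)) @^-1`
      ball (ratr (c lj.1 lj.2) : R) k.+1%:R^-1)).
  apply: bigsetI_measurable => lj _; rewrite -[X in measurable X]setTI.
  by apply: measurable_tnth => //; exact: measurable_realfun.measurable_ball.
rewrite -bigcap_seq; apply/seteqP; split=> t /= bt.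
  by move=> [l j] _ /=; have := bt l j; rewrite !mxE.
by move=> l j; rewrite !mxE; apply: (bt (l, j)); rewrite /= mem_index_enum.
Qed.

(* The matrix spaces of the library carry no measure; dV is the image of the
   4n-fold product of the Lebesgue measure of R. *)
Definition dV : set (borel R n) -> \bar R :=
  pushforward (lebesgue_tuple (n * 4)) point_of_tuple.

Lemma dV0 : dV set0 = 0%E.
Proof. by rewrite /dV /pushforward preimage_set0 measure0. Qed.

Lemma dV_ge0 A : (0 <= dV A)%E.
Proof. by rewrite /dV /pushforward. Qed.

Lemma dV_sigma_additive : semi_sigma_additive dV.
Proof.
move=> F mF tF mUF; rewrite /dV /pushforward preimage_bigcup.
have mpre A : measurable A -> measurable (point_of_tuple @^-1` A).
  by move=> mA; rewrite -[X in measurable X]setTI; exact: measurable_point_of_tuple.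
apply: measure_semi_sigma_additive.
- by move=> i; exact: mpre.
- apply/trivIsetP => /= i j _ _ ij; rewrite -preimage_setI.
  by move/trivIsetP : tF => /(_ _ _ _ _ ij) ->//; rewrite preimage_set0.
- by rewrite -preimage_bigcup; exact: mpre.
Qed.

HB.instance Definition _ := isMeasure.Build _ _ _ dV
  dV0 dV_ge0 dV_sigma_additive.

End lebesgue_space.
Arguments dV : clear implicits.

Section calculus.
Context {R : realType} {n : nat}.
Implicit Types (D : set (Hn R n)) (f : Hn R n -> R).

Definition enorm (x : Hn R n) : R := Num.sqrt (\sum_l \sum_j x l j ^+ 2).

Definition eball (a : Hn R n) (r : R) : set (Hn R n) :=
  [set x | enorm (x - a) < r].

(* partial l j is the derivative with respect to x_(4l+j) *)
Definition partial (l : 'I_n) (j : 'I_4) f : Hn R n -> R :=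
  fun x => 'D_(delta_mx l j) f x.

(* f is of class C^k on the open set D; its values off D are irrelevant *)
Fixpoint Ck (k : nat) D f : Prop :=
  (forall x, D x -> {for x, continuous f}) /\
  (if k is k'.+1 then
     forall l j, (forall x, D x -> derivable f x (delta_mx l j)) /\
                 Ck k' D (partial l j f)
   else True).

Definition test_function D f : Prop :=
  [/\ forall k, Ck k setT f,
      compact (closure [set x | f x != 0]) &
      closure [set x | f x != 0] `<=` D].

Definition cpartial (l : 'I_n) (j : 'I_4) (f : Hn R n -> R[i])
    (x : Hn R n) : R[i] :=
  partial l j (@complex.Re R \o f) x +i* partial l j (@complex.Im R \o f) x.

End calculus.

Section forms.
Context {R : realType} {n : nat}.

(* The family of coefficients of F = \sum_I f_I omega^I, where omega^I is the
   wedge of the omega^A, A in I, in increasing order of A. The indices l and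
   n + l are lshift n l and rshift n l. *)
Definition form : Type := {ffun {set 'I_(n + n)} -> R[i]}.

Definition omega (I : {set 'I_(n + n)}) : form := [ffun J => (J == I)%:R].

Definition omega1 (A : 'I_(n + n)) : form := omega [set A]%SET.

(* omega^I /\ omega^J = shuffle_sign I J omega^(I :|: J) for disjoint I, J *)
Definition shuffle_sign (I J : {set 'I_(n + n)}) : R[i] :=
  (-1) ^+ #|[set p : 'I_(n + n) * 'I_(n + n) |
              [&& p.1 \in I, p.2 \in J & (p.2 < p.1)%N]]%SET|.

Definition wedge (F G : form) : form :=
  [ffun K : {set 'I_(n + n)} => \sum_(I : {set 'I_(n + n)} | I \subset K)
     shuffle_sign I (K :\: I) * (F I * G (K :\: I))].

Definition one_form : form := omega finset.set0.

Definition wedge_pow (F : form) (k : nat) : form := iter k (wedge F) one_form.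

Definition nabla (A : 'I_(n + n)) (alpha : 'I_2) (f : Hn R n -> R[i])
    (x : Hn R n) : R[i] :=
  match fintype.split A with
  | inl l => if alpha == 0 then cpartial l 0 f x + 'i * cpartial l 1 f x
             else - cpartial l 2 f x - 'i * cpartial l 3 f x
  | inr l => if alpha == 0 then cpartial l 2 f x - 'i * cpartial l 3 f x
             else cpartial l 0 f x - 'i * cpartial l 1 f x
  end.

Definition dform (alpha : 'I_2) (F : Hn R n -> form) (x : Hn R n) : form :=
  [ffun K => \sum_I \sum_A
     nabla A alpha (fun y => F y I) x * wedge (omega1 A) (omega I) K].

Definition function_form (f : Hn R n -> R) (x : Hn R n) : form :=
  [ffun I => if I == finset.set0 then (f x)%:C else 0].

Definition Delta (f : Hn R n -> R) : Hn R n -> form :=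
  dform 0 (dform 1 (function_form f)).

Definition beta_n : form :=
  \sum_(l < n) wedge (omega1 (lshift n l)) (omega1 (rshift n l)).

Definition Omega_2n : form :=
  \big[wedge/one_form]_(l < n)
    wedge (omega1 (lshift n l)) (omega1 (rshift n l)).

(* the c such that F = c Omega_2n, for F of degree 2n *)
Definition top_coef (F : form) : R[i] :=
  F finset.setT / Omega_2n finset.setT.

(* \int_D u F for an extended-real function u and a form F of degree 2n *)
Definition form_integral (D : set (Hn R n)) (u : Hn R n -> \bar R)
    (F : Hn R n -> form) : R[i] :=
  fine (\int[dV R n]_(x in D) (u x * (@complex.Re R (top_coef (F x)))%:E))
  +i*
  fine (\int[dV R n]_(x in D) (u x * (@complex.Im R (top_coef (F x)))%:E)).

End forms.
Arguments form : clear implicits.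

Record quat (R : Type) : Type := Quat { q0 : R; q1 : R; q2 : R; q3 : R }.

Section quaternions.
Context {R : realType}.
Local Notation H := (quat R).

Definition quat_coords (x : H) : 'rV[R]_4 :=
  \row_j [:: q0 x; q1 x; q2 x; q3 x]`_j.

Definition quat_of_coords (v : 'rV[R]_4) : H := Quat (v 0 0) (v 0 1) (v 0 2) (v 0 3).

Lemma quat_coordsK : cancel quat_coords quat_of_coords.
Proof. by case=> a b c e; rewrite /quat_of_coords !mxE. Qed.

HB.instance Definition _ := Choice.copy H (can_type quat_coordsK).

Definition addq (x y : H) : H :=
  Quat (q0 x + q0 y) (q1 x + q1 y) (q2 x + q2 y) (q3 x + q3 y).

Definition oppq (x : H) : H := Quat (- q0 x) (- q1 x) (- q2 x) (- q3 x).

Definition mulq (x y : H) : H :=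
  Quat (q0 x * q0 y - q1 x * q1 y - q2 x * q2 y - q3 x * q3 y)
       (q0 x * q1 y + q1 x * q0 y + q2 x * q3 y - q3 x * q2 y)
       (q0 x * q2 y - q1 x * q3 y + q2 x * q0 y + q3 x * q1 y)
       (q0 x * q3 y + q1 x * q2 y - q2 x * q1 y + q3 x * q0 y).

Definition quat_of_real (r : R) : H := Quat r 0 0 0.

Lemma addqA : associative addq.
Proof. by move=> x y z; congr Quat; rewrite /= addrA. Qed.
Lemma addqC : commutative addq.
Proof. by move=> x y; congr Quat; rewrite addrC. Qed.
Lemma add0q : left_id (quat_of_real 0) addq.
Proof. by case=> *; congr Quat; rewrite /= add0r. Qed.
Lemma addNq : left_inverse (quat_of_real 0) oppq addq.
Proof. by move=> x; congr Quat; rewrite /= addNr. Qed.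

HB.instance Definition _ := GRing.isZmodule.Build H addqA addqC add0q addNq.

Lemma mulqA : associative mulq.
Proof. by move=> x y z; congr Quat => /=; ring. Qed.
Lemma mul1q : left_id (quat_of_real 1) mulq.
Proof. by case=> *; congr Quat => /=; ring. Qed.
Lemma mulq1 : right_id (quat_of_real 1) mulq.
Proof. by case=> *; congr Quat => /=; ring. Qed.
Lemma mulqDl : left_distributive mulq addq.
Proof. by move=> x y z; congr Quat => /=; ring. Qed.
Lemma mulqDr : right_distributive mulq addq.
Proof. by move=> x y z; congr Quat => /=; ring. Qed.
Lemma oneq_neq0 : quat_of_real 1 != 0.
Proof. by apply/eqP => -[] /eqP; rewrite oner_eq0. Qed.

HB.instance Definition _ := GRing.Zmodule_isNzRing.Build H
  mulqA mul1q mulq1 mulqDl mulqDr oneq_neq0.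

HB.instance Definition _ := Topological.copy H (initial_topology quat_coords).

Definition qi : H := Quat 0 1 0 0.
Definition qj : H := Quat 0 0 1 0.
Definition qk : H := Quat 0 0 0 1.
Definition qconj (x : H) : H := Quat (q0 x) (- q1 x) (- q2 x) (- q3 x).

Section matrices.
Context {n : nat}.
Implicit Types A U : 'M[H]_n.

Definition adjq A : 'M[H]_n := \matrix_(i, j) qconj (A j i).

Definition hyperhermitian A : Prop := adjq A = A.

Definition unitary U : Prop := U *m adjq U = 1%:M /\ adjq U *m U = 1%:M.

Definition elem_sym (m : nat) (lambda : 'rV[R]_n) : R :=
  \sum_(J : {set 'I_n} | #|J| == m) \prod_(j in J) lambda 0 j.

(* H_m(A), for hyperhermitian A: the value elem_sym m lambda, common to all the
   diagonalizations A = U diag(lambda) U^* *)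
Definition sym_eigen (m : nat) A : R :=
  xget 0 [set h | exists U (lambda : 'rV[R]_n),
    [/\ unitary U, A = U *m diag_mx (map_mx quat_of_real lambda) *m adjq U
      & h = elem_sym m lambda]].

Definition Gamma (m : nat) : set 'M[H]_n :=
  [set A | hyperhermitian A /\
           forall s : R, 0 <= s -> 0 < sym_eigen m ((quat_of_real s)%:M + A)].

End matrices.

Section qsh.
Context {n : nat}.
Implicit Types (D : set (Hn R n)).

Definition qpartial (l : 'I_n) (j : 'I_4) (f : Hn R n -> H) (x : Hn R n) : H :=
  Quat (partial l j (@q0 R \o f) x) (partial l j (@q1 R \o f) x)
       (partial l j (@q2 R \o f) x) (partial l j (@q3 R \o f) x).

(* d_dqbar and d_dq let i, j, k act on the left. For d_dq, which is only applied
   to real functions, the side is immaterial. *)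
Definition d_dqbar (l : 'I_n) (f : Hn R n -> H) (x : Hn R n) : H :=
  qpartial l 0 f x + qi * qpartial l 1 f x + qj * qpartial l 2 f x
  + qk * qpartial l 3 f x.

Definition d_dq (l : 'I_n) (f : Hn R n -> H) (x : Hn R n) : H :=
  qpartial l 0 f x - qi * qpartial l 1 f x - qj * qpartial l 2 f x
  - qk * qpartial l 3 f x.

Definition quat_hessian (v : Hn R n -> R) (x : Hn R n) : 'M[H]_n :=
  \matrix_(l, k) d_dqbar l (d_dq k (quat_of_real \o v)) x.

Definition smooth_qsh (m : nat) D (v : Hn R n -> R) : Prop :=
  Ck 2 D v /\ forall x, D x -> closure (@Gamma n m) (quat_hessian v x).

Definition upper_semicontinuous_on D (u : Hn R n -> \bar R) : Prop :=
  forall x, D x -> forall a : R, (u x < a%:E)%E ->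
    \forall y \near x, (u y < a%:E)%E.

Definition L1loc D (u : Hn R n -> \bar R) : Prop :=
  forall K : set (Hn R n), compact K -> K `<=` D -> (dV R n).-integrable K u.

(* The order of R[i] is used: 0 <= z means Im z = 0 and 0 <= Re z. *)
Definition QSH (m : nat) D (u : Hn R n -> \bar R) : Prop :=
  [/\ forall x, D x -> (u x < +oo)%E,
      upper_semicontinuous_on D u,
      L1loc D u &
      forall (v : 'I_(m - 1) -> Hn R n -> R) (w : Hn R n -> R),
        (forall i, Ck 4 D (v i) /\ smooth_qsh m D (v i)) ->
        test_function D w -> (forall x, 0 <= w x) ->
        0 <= form_integral D u (fun x =>
          wedge (\big[wedge/one_form]_(i < m - 1) Delta (v i) x)
            (wedge (wedge_pow beta_n (n - m)) (Delta w x)))].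

(* mu is the Radon measure Delta u /\ beta_n^(n-1) on D, seen as a Borel measure
   on H^n carried by D. Regularity is automatic, since mu is finite on the
   compact subsets of the open set D. *)
Definition is_Delta_beta_measure D (u : Hn R n -> \bar R)
    (mu : {measure set (borel R n) -> \bar R}) : Prop :=
  [/\ mu (~` D) = 0%E,
      forall K : set (Hn R n), compact K -> K `<=` D -> (mu K < +oo)%E &
      forall w : Hn R n -> R, test_function D w ->
        (fine (\int[mu]_(x in D) (w x)%:E))%:C =
        form_integral D u (fun x =>
          wedge (wedge_pow beta_n (n - 1)) (Delta w x))].

Definition lelong_ratio (m : nat) (mu : {measure set (borel R n) -> \bar R})
    (a : Hn R n) (r : R) : \bar R :=
  (mu (eball a r) * ((r `^ ((4 * n * (m - 1))%:R / m%:R))^-1)%:E)%E.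

End qsh.
End quaternions.

(* Main.v *)
Require Import Defs.
From HB Require Import structures.
From mathcomp Require Import all_boot all_order all_algebra.
From mathcomp Require Import all_classical all_reals all_analysis.
From mathcomp Require Import ring lra complex zify.
Set Implicit Arguments.
Unset Strict Implicit.
Unset Printing Implicit Defensive.

Import Order.TTheory GRing.Theory Num.Theory.
Import numFieldNormedType.Exports.
Local Open Scope classical_set_scope.
Local Open Scope ring_scope.
Local Open Scope complex_scope.

(** Everything is done with functions of the squared distance P(x) = |x - a|^2.
    For a smooth function phi of one variable,
      Delta (phi o P) = 8 phi'(P) beta_n + phi''(P) gamma,
    where gamma = d_0 P /\ d_1 P is a product of two 1-forms ([Delta_radial]).
    Hence gamma /\ gamma = 0, and gamma commutes with beta_n. Expanding the
    powers with these two rules gives the identity of forms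
      Delta v ^ (m-1) /\ beta_n^(n-m) /\ Delta w = beta_n^(n-1) /\ Delta z
    for v = phi o P, w = psi o P and z = chi o P, as soon as
    chi' = (8 phi')^(m-1) psi' ([radial_form_identity]).

    The quaternionic Hessian of phi o P at x is 8 phi' I + 4 phi'' y y^*, with
    y = x - a. It is diagonalized by a Householder reflection, its eigenvalues
    are 8 phi' with multiplicity n - 1 and 8 phi' + 4 phi'' P, and it is in
    Gamma_m when phi' > 0 and 2 n phi' + m P phi'' > 0 ([smooth_qsh_radial]).
    These inequalities hold for 8 phi'(t) = (t + e)^(-2n/m), e > 0. This is a
    smooth approximation of the fundamental solution, for which e = 0 and the
    second inequality is an equality; and P^(-(m-1) 2n/m) is the weight
    |x - a|^(-4n(m-1)/m) of the theorem.

    So, for every radial test function w = psi o P >= 0 on Omega, the definition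
    of QSH_m and the identity of forms give 0 <= \int (chi o P) dmu, where mu is
    the measure Delta u /\ beta_n^(n-1) and chi' = (t + e)^(-(m-1) 2n/m) psi'
    ([radial_pairing_ge0]). With psi a smooth approximation of the indicator
    function of [r^2, s^2], chi approximates
      s^(-4n(m-1)/m) 1_[0, s^2] - r^(-4n(m-1)/m) 1_[0, r^2],
    and the inequality becomes the monotonicity of the ratio in the limit
    ([mass_inequality], [mass_ratio_mono]). A nonnegative nondecreasing function
    has a nonnegative limit at 0. *)

(** * The exterior algebra as an associative algebra *)

Section Ext.
Context {R : realType} {n : nat}.
Local Notation form := (Defs.form R n).
Local Notation ix := {set 'I_(n + n)}.
Local Notation disj I J := (fintype.disjoint (mem I) (mem J)).
Implicit Types (F G H : form) (I J K L : ix).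

(** The number of pairs to be exchanged when sorting the elements of I followed
    by those of J. *)
Definition inversions I J : nat := \sum_(i in I) \sum_(j in J) (j < i)%N.

Lemma shuffle_signE I J : shuffle_sign I J = (-1) ^+ inversions I J :> R[i].
Proof.
congr (_ ^+ _); rewrite /inversions pair_big -sum1dep_card big_mkcond/=.
rewrite [RHS]big_mkcond/=; apply: eq_bigr => -[i j] _ /=.
by case: (i \in I); case: (j \in J); case: (j < i)%N.
Qed.

Let sum_disjU I J (f : 'I_(n + n) -> nat) : disj I J ->
  (\sum_(i in (I :|: J)%SET) f i = \sum_(i in I) f i + \sum_(i in J) f i)%N.
Proof. by move=> IJ; rewrite -bigU//; apply: eq_bigl => i; rewrite !inE. Qed.

Lemma shuffle_sign_assoc I J K :
  (disj I J) -> (disj J K) ->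
  shuffle_sign I J * shuffle_sign (I :|: J)%SET K =
  shuffle_sign I (J :|: K)%SET * shuffle_sign J K :> R[i].
Proof.
move=> dIJ dJK; rewrite !shuffle_signE -!exprD; congr (_ ^+ _).
have -> : inversions (I :|: J)%SET K = (inversions I K + inversions J K)%N.
  exact: sum_disjU.
have -> : inversions I (J :|: K)%SET = (inversions I J + inversions I K)%N.
  by rewrite /inversions -big_split/=; apply: eq_bigr => i _; exact: sum_disjU.
by rewrite addnA.
Qed.

Lemma wedgeA : associative (@wedge R n).
Proof.
move=> F G H; apply/ffunP => K; rewrite !ffunE.
under eq_bigr => I _ do rewrite ffunE !mulr_sumr.
under [RHS]eq_bigr => L _ do rewrite ffunE mulr_suml mulr_sumr.
rewrite [RHS](exchange_big_dep (fun I => I \subset K))/=; last first.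
  by move=> L I LK IL; exact: fintype.subset_trans LK.
apply: eq_bigr => I IK.
rewrite [RHS](reindex_onto (fun J => I :|: J)%SET (fun L => L :\: I)%SET)/=; last first.
  move=> L /andP[_ IL]; apply/setP => i; rewrite !inE.
  by case: (boolP (i \in I)) => // /(fintype.subsetP IL) ->.
apply: eq_big => [J|J JKI].
  rewrite finset.subUset IK finset.subsetUl andbT/= finset.subsetD; congr andb.
  rewrite finset.setDUl finset.setDv finset.set0U.
  apply/idP/eqP => [/finset.setDidPl//|<-].
  by rewrite -finset.setI_eq0; apply/eqP/setP => i; rewrite !inE; case: (i \in I); rewrite ?andbF.
have /andP[JK dJI] : (J \subset K) && (disj J I) by rewrite -finset.subsetD.
have -> : ((I :|: J) :\: I = J)%SET.
  by rewrite finset.setDUl finset.setDv finset.set0U; apply/finset.setDidPl.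
have -> : ((K :\: I) :\: J = K :\: (I :|: J))%SET by rewrite finset.setDDl.
have hs : shuffle_sign I J * shuffle_sign (I :|: J)%SET (K :\: (I :|: J))%SET
  = shuffle_sign I (K :\: I)%SET * shuffle_sign J (K :\: (I :|: J))%SET :> R[i].
  rewrite shuffle_sign_assoc; last 2 first.
  - by rewrite disjoint_sym.
  - by rewrite -finset.setI_eq0; apply/eqP/setP => i; rewrite !inE; case: (i \in J);
      rewrite ?orbT ?andbF.
  congr (shuffle_sign _ _ * _); apply/setP => i; rewrite !inE.
  case: (boolP (i \in J)) => iJ /=; last by rewrite orbF.
  rewrite (fintype.subsetP JK _ iJ) andbT; apply/esym/negP => iI.
  by move: dJI; rewrite -finset.setI_eq0 => /eqP/setP/(_ i); rewrite !inE iJ iI.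
transitivity ((shuffle_sign I (K :\: I)%SET * shuffle_sign J (K :\: (I :|: J))%SET)
  * (F I * G J * H (K :\: (I :|: J))%SET)); first by ring.
by rewrite -hs; ring.
Qed.

Lemma wedge_omega I J : wedge (omega I) (omega J) =
  (if (disj I J) then [ffun K => shuffle_sign I J * omega (I :|: J)%SET K] else 0)
  :> form.
Proof.
apply/ffunP => K; rewrite ffunE.
have E L : L \subset K -> L != I ->
    shuffle_sign L (K :\: L)%SET * (omega I L * omega J (K :\: L)%SET) = 0 :> R[i].
  by move=> _ /negbTE LI; rewrite ffunE LI mul0r mulr0.
case: (boolP (I \subset K)) => IK; last first.
  rewrite big1 => [|L LK]; last first.
    by apply: E => //; apply: contraNneq IK => <-.
  case: ifP => // _; rewrite !ffunE//.
  case: eqP => [KE|_]; last by rewrite mulr0.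
  by move: IK; rewrite KE finset.subsetUl.
rewrite (bigD1 I)//= big1 => [|L /andP[]]; last exact: E.
rewrite addr0 !ffunE eqxx mul1r.
have -> : (K :\: I == J)%SET = (disj I J) && (K == I :|: J)%SET.
  apply/eqP/andP => [<-|[dIJ /eqP->]].
    split; first by rewrite -finset.setI_eq0 finset.setIDA finset.setDIl finset.setDv finset.set0I.
    by apply/eqP/setP => i; rewrite !inE; case: (boolP (i \in I)) => // /(fintype.subsetP IK).
  by rewrite finset.setDUl finset.setDv finset.set0U; apply/finset.setDidPl; rewrite disjoint_sym.
case: (boolP (disj I J)) => dIJ; rewrite !ffunE ?mulr0//=.
case: eqP => [->|]; rewrite ?mulr0//.
have -> : ((I :|: J) :\: I = J)%SET; last by [].
by rewrite finset.setDUl finset.setDv finset.set0U; apply/finset.setDidPl; rewrite disjoint_sym.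
Qed.

Lemma one_formE K : one_form K = (K == finset.set0)%:R :> R[i].
Proof. by rewrite ffunE. Qed.

Lemma wedge1l : left_id (@one_form R n) (@wedge R n).
Proof.
move=> F; apply/ffunP => K; rewrite ffunE (bigD1 finset.set0) ?finset.sub0set//= big1.
  rewrite addr0 one_formE eqxx mul1r finset.setD0 shuffle_signE /inversions.
  by rewrite finset.big_set0 mul1r.
by move=> I /andP[_ /negbTE I0]; rewrite one_formE I0 mul0r mulr0.
Qed.

Lemma wedge1r : right_id (@one_form R n) (@wedge R n).
Proof.
move=> F; apply/ffunP => K; rewrite ffunE (bigD1 K)//= big1.
  rewrite addr0 one_formE finset.setDv eqxx mulr1 shuffle_signE /inversions.
  by rewrite big1 ?mul1r// => i _; rewrite finset.big_set0.
move=> I /andP[IK nIK]; rewrite one_formE (_ : _ == _ = false) ?mulr0//.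
by apply/negbTE; rewrite finset.setD_eq0; apply: contra nIK => KI; rewrite finset.eqEsubset IK.
Qed.

Lemma wedgeDl : left_distributive (@wedge R n) +%R.
Proof.
move=> F G H; apply/ffunP => K; rewrite !ffunE -big_split; apply: eq_bigr => I _ /=.
by rewrite ffunE; ring.
Qed.

Lemma wedgeDr : right_distributive (@wedge R n) +%R.
Proof.
move=> F G H; apply/ffunP => K; rewrite !ffunE -big_split; apply: eq_bigr => I _ /=.
by rewrite ffunE; ring.
Qed.

Lemma one_form_neq0 : one_form != 0 :> form.
Proof.
apply/eqP => /ffunP/(_ finset.set0); rewrite one_formE eqxx ffunE => /eqP.
by rewrite oner_eq0.
Qed.

(** Multiplication of a form by a complex scalar. *)
Definition scale_form (c : R[i]) F : form := [ffun K => c * F K].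

Lemma scale_formA c d F : scale_form c (scale_form d F) = scale_form (c * d) F.
Proof. by apply/ffunP => K; rewrite !ffunE mulrA. Qed.

Lemma scale_form1 : left_id 1 scale_form.
Proof. by move=> F; apply/ffunP => K; rewrite !ffunE mul1r. Qed.

Lemma scale_formDr : right_distributive scale_form +%R.
Proof. by move=> c F G; apply/ffunP => K; rewrite !ffunE mulrDr. Qed.

Lemma scale_formDl F : {morph scale_form ^~ F : c d / c + d}.
Proof. by move=> c d; apply/ffunP => K; rewrite !ffunE mulrDl. Qed.

Lemma scale_form_wedgel c F G :
  scale_form c (wedge F G) = wedge (scale_form c F) G.
Proof.
apply/ffunP => K; rewrite !ffunE mulr_sumr; apply: eq_bigr => I _.
by rewrite ffunE; ring.
Qed.

Lemma scale_form_wedger c F G :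
  scale_form c (wedge F G) = wedge F (scale_form c G).
Proof.
apply/ffunP => K; rewrite !ffunE mulr_sumr; apply: eq_bigr => I _.
by rewrite ffunE; ring.
Qed.

End Ext.

(** With the wedge product as multiplication, forms are an algebra over R[i]. *)
HB.instance Definition _ (R : realType) n :=
  GRing.Zmodule.copy (Defs.form R n) {ffun {set 'I_(n + n)} -> R[i]}.
HB.instance Definition _ (R : realType) n :=
  GRing.Zmodule_isNzRing.Build (Defs.form R n)
    wedgeA wedge1l wedge1r wedgeDl wedgeDr one_form_neq0.
HB.instance Definition _ (R : realType) n :=
  GRing.Zmodule_isLmodule.Build R[i] (Defs.form R n)
    scale_formA scale_form1 scale_formDr scale_formDl.
HB.instance Definition _ (R : realType) n :=
  GRing.Lmodule_isLalgebra.Build R[i] (Defs.form R n) scale_form_wedgel.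
HB.instance Definition _ (R : realType) n :=
  GRing.Lalgebra_isAlgebra.Build R[i] (Defs.form R n) scale_form_wedger.

Section ExtRing.
Context {R : realType} {n : nat}.
Local Notation form := (Defs.form R n).
Implicit Types (F G : form) (c d : 'I_(n + n) -> R[i]).

Lemma scale_formE (x : R[i]) F K : (x *: F) K = x * F K.
Proof. by rewrite /GRing.scale/= ffunE. Qed.

Lemma wedgeE F G : wedge F G = F * G. Proof. by []. Qed.

Lemma wedge_powE F k : wedge_pow F k = F ^+ k.
Proof. by elim: k => [//|k IH]; rewrite exprS -IH. Qed.

Lemma big_wedge F k : \big[wedge/one_form]_(i < k) F = F ^+ k.
Proof. by rewrite big_const_ord -wedge_powE. Qed.

(** The 1-form with coefficients c. *)
Definition covector c : form := \sum_A c A *: omega1 A.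

Lemma omega1_anticomm A B : omega1 A * omega1 B = - (omega1 B * omega1 A) :> form.
Proof.
rewrite -!wedgeE /omega1 !wedge_omega.
have d1 (X Y : 'I_(n + n)) : fintype.disjoint (mem [set X]%SET) (mem [set Y]%SET) = (X != Y).
  by rewrite disjoints1 inE.
rewrite !d1 eq_sym; case: (eqVneq B A) => [_|BA /=]; first by rewrite oppr0.
apply/ffunP => K; rewrite !ffunE (finset.setUC [set A]%SET) -mulNr; congr (_ * _).
rewrite !shuffle_signE /inversions !finset.big_set1.
have : (A : nat) != B by rewrite eq_sym.
by rewrite neq_ltn => /orP[] h; rewrite h ltnNge (ltnW h)/= ?expr0 ?expr1 ?opprK.
Qed.

Lemma covector_anticomm c d : covector c * covector d = - (covector d * covector c).
Proof.
rewrite /covector !mulr_suml -sumrN.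
under eq_bigr => A _ do rewrite mulr_sumr.
rewrite exchange_big/=; apply: eq_bigr => B _; rewrite mulr_sumr -sumrN.
apply: eq_bigr => A _.
by rewrite -!scalerAl -!scalerAr !scalerA omega1_anticomm scalerN (mulrC (d B)).
Qed.

Lemma covector_sqr c : covector c * covector c = 0.
Proof.
have h : (2%:R : R[i]) *: (covector c * covector c) = 0.
  by rewrite scaler_nat mulr2n {1}covector_anticomm addNr.
by rewrite -[LHS]scale1r -(mulVf (_ : 2%:R != 0 :> R[i])) ?pnatr_eq0// -scalerA h scaler0.
Qed.

Lemma covector2_sqr c d :
  (covector c * covector d) * (covector c * covector d) = 0.
Proof.
rewrite mulrA -(mulrA (covector c)) (covector_anticomm d c) mulrN mulNr.
by rewrite mulrA covector_sqr !mul0r oppr0.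
Qed.

Lemma covector2_comm c d c' d' :
  GRing.comm (covector c * covector d) (covector c' * covector d').
Proof.
have h e : GRing.comm (covector e) (covector c * covector d).
  rewrite /GRing.comm mulrA (covector_anticomm e c) mulNr -(mulrA _ (covector e)).
  rewrite (covector_anticomm e d).
  by rewrite mulrN opprK mulrA.
by apply/GRing.commr_sym/commr_sym/commrM; apply/commr_sym; exact: h.
Qed.

End ExtRing.

Section PowerIdentity.
Variables (K : comNzRingType) (A : algType K).
Implicit Types (a b c d : K) (x y : A).

Lemma exprD_sqr0 a b x y k : GRing.comm x y -> y * y = 0 ->
  (a *: x + b *: y) ^+ k =
  a ^+ k *: x ^+ k + (k%:R * a ^+ k.-1 * b) *: (x ^+ k.-1 * y).
Proof.
move=> xy yy; elim: k => [|k IH].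
  by rewrite !expr0 !mul0r scale0r addr0 scale1r.
rewrite exprS IH mulrDl !mulrDr -!scalerAl -!scalerAr !scalerA/=.
have yX j : y * x ^+ j = x ^+ j * y by apply: commrX; exact: commr_sym.
rewrite -!exprS !(mulrA y) !yX -(mulrA _ y y) yy mulr0 scaler0 addr0.
rewrite -addrA; congr (_ + _).
case: k {IH} => [|k]/=.
  by rewrite !mul0r mulr0 scale0r add0r !expr0 !mul1r mulr1.
rewrite (mulrA x) -(exprS x) -scalerDl; congr (_ *: _).
by rewrite -[k.+2]addn1 natrD (exprS a k); ring.
Qed.

(** If b = a' / 8 and d = c' / 8, then the coefficient of y on the right is
    (a ^+ k * c)' / 8: the combinations of x and y of this kind are stable under
    the product on the left, up to powers of x. *)
Lemma radial_product a b c d x y k l : GRing.comm x y -> y * y = 0 ->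
  (a *: x + b *: y) ^+ k * (x ^+ l * (c *: x + d *: y)) =
  x ^+ (k + l) * ((a ^+ k * c) *: x + (a ^+ k * d + k%:R * a ^+ k.-1 * b * c) *: y).
Proof.
move=> xy yy; rewrite exprD_sqr0//.
have yX j : y * x ^+ j = x ^+ j * y by apply: commrX; exact: commr_sym.
rewrite !mulrDl !mulrDr -!scalerAl -!scalerAr !scalerA.
rewrite -(mulrA _ y (_ * x)) -(mulrA _ y (_ * y)) (mulrA y (x ^+ l) y) yX -(mulrA _ y y) yy.
rewrite !mulr0 scaler0 addr0 scalerDl -!addrA !mulrA -exprD; congr (_ + (_ + _)).
rewrite -(mulrA _ y) yX -(mulrA _ _ x) -mulrA -(mulrA _ y) -xy.
case: k => [|k]; first by rewrite !mul0r !scale0r.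
rewrite [k.+1.-1]/= (mulrA (x ^+ l)) -exprSr (mulrA (x ^+ k)) -exprD.
by rewrite addnS addSn !mulrA.
Qed.

End PowerIdentity.

(** * Radial functions *)

Section Radial.
Context {R : realType} {n : nat}.
Local Notation Hn := (Hn R n).
Implicit Types (f g : Hn -> R) (x a v : Hn) (l : 'I_n) (j : 'I_4).

(** The derivative along v is the derivative at 0 of the restriction to a line. *)
Lemma is_derive_line f x v (df : R) :
  is_derive (0 : R) 1 (fun h : R => f (h *: v + x)) df -> is_derive x v f df.
Proof.
have E : (fun h : R => h^-1 *: ((f \o shift x) (h *: v) - f x)) =
         (fun h : R => h^-1 *: (((fun h => f (h *: v + x)) \o shift 0) (h *: (1 : R))
                        - (fun h => f (h *: v + x)) 0)).
  by apply/funext => h /=; rewrite addr0 scale0r add0r [h *: 1]mulr1.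
by case=> d1 d2; split; [rewrite /derivable E|rewrite /derive E].
Qed.

Lemma is_derive_coord x v l j : is_derive x v (fun y : Hn => y l j) (v l j).
Proof.
apply: is_derive_line.
rewrite (_ : (fun h => _) = (fun h : R => h * v l j + x l j)); last first.
  by apply/funext => h; rewrite !mxE.
by apply: is_derive_eq; rewrite scaler0 add0r addr0 [_%:A]mulr1.
Qed.

Lemma is_derive_comp_real (phi : R -> R) f x v (dphi df : R) :
  is_derive x v f df -> is_derive (f x) 1 phi dphi ->
  is_derive x v (phi \o f) (dphi * df).
Proof.
move=> hf hphi; apply: is_derive_line.
have hl : is_derive (0 : R) 1 (fun h : R => f (h *: v + x)) df.
  have E : (fun h : R => h^-1 *: ((f \o shift x) (h *: v) - f x)) =
         (fun h : R => h^-1 *: (((fun h => f (h *: v + x)) \o shift 0) (h *: (1 : R))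
                        - (fun h => f (h *: v + x)) 0)).
    by apply/funext => h /=; rewrite addr0 scale0r add0r [h *: 1]mulr1.
  by case: hf => d1 d2; split; [rewrite /derivable -E|rewrite /derive -E].
apply: (@is_derive1_comp R phi (fun h => f (h *: v + x))) => //.
by rewrite scale0r add0r.
Qed.

(** The squared Euclidean distance from a to x. *)
Definition sqdist a x : R := \sum_l \sum_j (x l j - a l j) ^+ 2.

Lemma is_derive_sqdist a x v :
  is_derive x v (sqdist a) (\sum_l \sum_j 2 * (x l j - a l j) * v l j).
Proof.
rewrite /sqdist.
have -> : (fun x : Hn => \sum_l \sum_j (x l j - a l j) ^+ 2) =
  \sum_l \sum_j ((fun x : Hn => x l j) - cst (a l j)) ^+ 2.
  apply/funext => y; rewrite fct_sumE; apply: eq_bigr => l _.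
  by rewrite fct_sumE; apply: eq_bigr => j _.
apply: is_derive_sum => l; apply: is_derive_sum => j.
have := is_derive_coord x v l j => h.
apply: is_derive_eq.
by rewrite subr0 expr1.
Qed.

Lemma is_derive_sqdist_delta a x l j :
  is_derive x (delta_mx l j) (sqdist a) (2 * (x l j - a l j)).
Proof.
have h := is_derive_sqdist a x (delta_mx l j).
apply: is_derive_eq.
rewrite (bigD1 l)//= [X in _ + X]big1 ?addr0 => [|l' /negbTE ll']; last first.
  by rewrite big1// => j' _; rewrite mxE ll' mulr0.
rewrite (bigD1 j)//= [X in _ + X]big1 ?addr0 => [|j' /negbTE jj']; last first.
  by rewrite mxE jj' andbF mulr0.
by rewrite mxE !eqxx mulr1.
Qed.

Lemma sqdist_ge0 a x : 0 <= sqdist a x.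
Proof. by apply: sumr_ge0 => l _; apply: sumr_ge0 => j _; exact: sqr_ge0. Qed.

Lemma continuous_sqdist a : continuous (sqdist a).
Proof.
rewrite /sqdist; apply: (@continuous_big _ _ _ _ xpredT add_continuous) => l _.
apply: (@continuous_big _ _ _ _ xpredT add_continuous) => j _ x.
have h : {for x, continuous (fun y : Hn => y l j - a l j)}.
  by apply: continuousB; [exact: (@coord_continuous R n 4 l j x)|exact: cst_continuous].
exact: (cvgM h h).
Qed.

Lemma partialE f x l j df : is_derive x (delta_mx l j) f df -> partial l j f x = df.
Proof. by move=> h; rewrite /partial derive_val. Qed.

Lemma Ck_setT k (D : set Hn) f : Ck k setT f -> Ck k D f.
Proof.
elim: k f => [|k IH] f [cf df]; split;
  [by move=> x _; exact: cf|by []|by move=> x _; exact: cf|move=> l j].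
by have [d1 d2] := df l j; split=> [x _|]; [exact: d1|exact: IH].
Qed.

Lemma Ck_le k k' (D : set Hn) f : (k' <= k)%N -> Ck k D f -> Ck k' D f.
Proof.
elim: k' k f => [|k' IH] [|k] f //= kk' [cf df]; split=> // l j.
by have [d1 d2] := df l j; split=> //; exact: IH d2.
Qed.

Lemma CkD k f g : Ck k setT f -> Ck k setT g -> Ck k setT (f \+ g).
Proof.
elim: k f g => [|k IH] f g [cf df] [cg dg]; split=> //.
- by move=> x _; apply: continuousD; [exact: cf|exact: cg].
- by move=> x _; apply: continuousD; [exact: cf|exact: cg].
move=> l j.
have [d1 d2] := df l j; have [e1 e2] := dg l j; split=> [x _|].
  by apply: derivableD; [exact: d1|exact: e1].
rewrite (_ : partial l j _ = partial l j f \+ partial l j g); first exact: IH.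
by apply/funext => x; rewrite /partial deriveD//; [exact: d1|exact: e1].
Qed.

Lemma CkM k f g : Ck k setT f -> Ck k setT g -> Ck k setT (f \* g).
Proof.
elim: k f g => [|k IH] f g [cf df] [cg dg]; split=> //.
- by move=> x _; apply: continuousM; [exact: cf|exact: cg].
- by move=> x _; apply: continuousM; [exact: cf|exact: cg].
move=> l j.
have [d1 d2] := df l j; have [e1 e2] := dg l j; split=> [x _|].
  by apply: derivableM; [exact: d1|exact: e1].
rewrite (_ : partial l j _ = (f \* partial l j g) \+ (g \* partial l j f)).
  by apply: CkD; apply: IH => //; [apply: (@Ck_le k.+1)|apply: (@Ck_le k.+1)].
by apply/funext => x; rewrite /partial deriveM//; [exact: d1|exact: e1].
Qed.

Lemma Ck_cst k (c : R) : Ck k setT (fun _ : Hn => c).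
Proof.
elim: k c => [|k IH] c; split;
  [by move=> x _; exact: cst_continuous|by []|by move=> x _; exact: cst_continuous|move=> l j].
split=> [x _|]; first exact: derivable_cst.
rewrite (_ : partial l j _ = fun=> 0); first exact: IH.
by apply/funext => x; apply: partialE; exact: is_derive_cst.
Qed.

Lemma Ck_coord k l j : Ck k setT (fun x : Hn => x l j).
Proof.
case: k => [|k]; split=> //; try by move=> x _; exact: (@coord_continuous R n 4 l j x).
move=> l' j'.
split=> [x _|]; first by have [] := is_derive_coord x (delta_mx l' j') l j.
rewrite (_ : partial l' j' _ = fun=> delta_mx l' j' l j); first exact: Ck_cst.
by apply/funext => x; apply: partialE; exact: is_derive_coord.
Qed.

(** [smooth_on k phi]: the function phi of a real variable is k times
    differentiable, with continuous derivatives, at every nonnegative point (in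
    the two-sided sense). The derivatives are existentially quantified, so that
    nothing has to be said about negative arguments. *)
Fixpoint smooth_on (k : nat) (phi : R -> R) : Prop :=
  if k is k'.+1 then
    exists2 dphi : R -> R, (forall t : R, 0 <= t -> is_derive t 1 phi (dphi t)) & smooth_on k' dphi
  else forall t : R, 0 <= t -> {for t, continuous phi}.

Lemma is_derive_continuous (phi : R -> R) (t d : R) :
  is_derive t 1 phi d -> {for t, continuous phi}.
Proof. by case=> h _; apply: differentiable_continuous; exact/derivable1_diffP. Qed.

Lemma smooth_on_continuous k phi (t : R) :
  smooth_on k phi -> 0 <= t -> {for t, continuous phi}.
Proof.
case: k => [|k] /=; first exact.
by move=> [dphi h _] t0; apply: (@is_derive_continuous _ _ (dphi t)); exact: h.
Qed.

Lemma is_derive_sqdist_comp a (phi dphi : R -> R) l j x :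
  (forall t : R, 0 <= t -> is_derive t 1 phi (dphi t)) ->
  is_derive x (delta_mx l j) (phi \o sqdist a)
    (dphi (sqdist a x) * (2 * (x l j - a l j))).
Proof.
move=> h; apply: is_derive_comp_real; first exact: is_derive_sqdist_delta.
exact/h/sqdist_ge0.
Qed.

Lemma Ck_radial a k phi : smooth_on k phi -> Ck k setT (phi \o sqdist a).
Proof.
elim: k phi => [|k IH] phi sphi; split=> //.
- move=> x _; apply: continuous_comp; first exact: continuous_sqdist.
  exact/sphi/sqdist_ge0.
- move=> x _; apply: continuous_comp; first exact: continuous_sqdist.
  exact/(smooth_on_continuous sphi)/sqdist_ge0.
move: sphi => [dphi h sdphi] l j; split=> [x _|].
  by have [] := is_derive_sqdist_comp a l j x h.
rewrite (_ : partial l j _ = (dphi \o sqdist a) \*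
    ((fun=> 2) \* ((fun x => x l j) \+ (fun=> - a l j)))); last first.
  by apply/funext => x; apply: partialE; exact: is_derive_sqdist_comp.
apply: CkM; first exact: IH.
apply: CkM; first exact: Ck_cst.
by apply: CkD; [exact: Ck_coord|exact: Ck_cst].
Qed.

End Radial.

(** * The form Delta of a radial function *)

Section RadialForm.
Context {R : realType} {n : nat}.
Local Notation Hn := (Hn R n).
Local Notation form := (Defs.form R n).
Implicit Types (x a : Hn) (A B : 'I_(n + n)).

Lemma dformE (alpha : 'I_2) (F : Hn -> form) x :
  dform alpha F x =
  \sum_I \sum_A nabla A alpha (fun y => F y I) x *: (omega1 A * omega I).
Proof.
apply/ffunP => K; rewrite ffunE sum_ffunE; apply: eq_bigr => I _.
by rewrite sum_ffunE; apply: eq_bigr => A _; rewrite scale_formE.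
Qed.

Lemma cpartial0 l j x : cpartial l j (fun=> 0) x = 0 :> R[i].
Proof.
rewrite /cpartial (_ : _ \o _ = cst 0)// (_ : @complex.Im R \o _ = cst 0)//.
by rewrite !(@partialE _ _ _ _ _ _ 0).
Qed.

Lemma nabla0 A alpha x : nabla A alpha (fun=> 0) x = 0 :> R[i].
Proof.
by rewrite /nabla; case: fintype.split => l; case: ifP => _;
  rewrite !cpartial0 ?oppr0 mulr0 ?subr0 ?addr0.
Qed.

Lemma dform_function alpha (v : Hn -> R) x :
  dform alpha (function_form v) x =
  covector (fun A => nabla A alpha (fun y => (v y)%:C) x).
Proof.
rewrite dformE (bigD1 finset.set0)//= [X in _ + X]big1 ?addr0 => [|I /negbTE I0].
  apply: eq_bigr => A _; rewrite -[omega finset.set0]/(1 : form) mulr1.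
  rewrite (_ : (fun y => _) = (fun y => (v y)%:C))//; apply/funext => y.
  by rewrite /function_form ffunE eqxx.
rewrite big1// => A _; rewrite (_ : (fun y => _) = fun=> 0) ?nabla0 ?scale0r//.
by apply/funext => y; rewrite ffunE I0.
Qed.

Lemma covectorE (c : 'I_(n + n) -> R[i]) (I : {set 'I_(n + n)}) :
  covector c I = \sum_B (I == [set B]%SET)%:R * c B.
Proof.
rewrite sum_ffunE; apply: eq_bigr => B _.
by rewrite scale_formE ffunE mulrC.
Qed.

Lemma dform_covector alpha (c : Hn -> 'I_(n + n) -> R[i]) x :
  dform alpha (fun y => covector (c y)) x =
  \sum_B \sum_A nabla A alpha (fun y => c y B) x *: (omega1 A * omega1 B).
Proof.
have E (I : {set 'I_(n + n)}) A : nabla A alpha (fun y => covector (c y) I) x =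
    \sum_B (I == [set B]%SET)%:R * nabla A alpha (fun y => c y B) x.
  have [[B0 /= ->]|I0] := pselect (exists B, I = [set B]%SET).
    rewrite (bigD1 B0)//= eqxx mul1r big1 ?addr0 => [|B /negbTE BB0].
      rewrite (_ : (fun y => _) = (fun y => c y B0))//; apply/funext => y.
      rewrite covectorE (bigD1 B0)//= eqxx mul1r.
      rewrite big1 ?addr0// => B /negbTE BB0.
      by rewrite (inj_eq finset.set1_inj) eq_sym BB0 mul0r.
    by rewrite (inj_eq finset.set1_inj) eq_sym BB0 mul0r.
  have I0' B : (I == [set B]%SET) = false by apply/eqP => h; apply: I0; exists B.
  rewrite [RHS]big1 => [|B _]; last by rewrite I0' mul0r.
  rewrite (_ : (fun y => _) = fun=> 0) ?nabla0//; apply/funext => y.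
  by rewrite covectorE big1// => B _; rewrite I0' mul0r.
rewrite dformE.
under eq_bigr => I _ do under eq_bigr => A _ do rewrite E scaler_suml.
under eq_bigr => I _ do rewrite exchange_big/=.
rewrite exchange_big/=; apply: eq_bigr => B _.
rewrite (bigD1 [set B]%SET)//= [X in _ + X]big1 ?addr0 => [|I /negbTE IB].
  by apply: eq_bigr => A _; rewrite eqxx mul1r.
by apply: big1 => A _; rewrite IB mul0r scale0r.
Qed.

(** [grad_sqdist a alpha x A] is [nabla A alpha] of the squared distance to a. *)
Definition grad_sqdist a (alpha : 'I_2) x A : R[i] :=
  let y l j := 2 * (x l j - a l j) in
  match fintype.split A with
  | inl l => if alpha == 0 then y l 0 +i* y l 1 else (- y l 2%:R) +i* (- y l 3%:R)
  | inr l => if alpha == 0 then y l 2%:R -i* y l 3%:R else y l 0 -i* y l 1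
  end.

Lemma cpartial_derive l j (f : Hn -> R[i]) x (d e : R) :
  is_derive x (delta_mx l j) (@complex.Re R \o f) d ->
  is_derive x (delta_mx l j) (@complex.Im R \o f) e ->
  cpartial l j f x = d +i* e.
Proof. by move=> hd he; rewrite /cpartial (partialE hd) (partialE he). Qed.

Lemma nabla_radial a A alpha (phi dphi : R -> R) x :
  (forall t : R, 0 <= t -> is_derive t (1 : R) phi (dphi t)) ->
  nabla A alpha (fun y => (phi (sqdist a y))%:C) x =
  (dphi (sqdist a x))%:C * grad_sqdist a alpha x A.
Proof.
move=> h; rewrite /nabla /grad_sqdist.
have cE l j : cpartial l j (fun y => (phi (sqdist a y))%:C) x =
    (dphi (sqdist a x) * (2 * (x l j - a l j)))%:C.
  apply: cpartial_derive; first exact: is_derive_sqdist_comp.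
  exact: is_derive_cst.
by case: fintype.split => l; case: ifP => _; rewrite !cE; simpc; congr (_ +i* _); ring.
Qed.

End RadialForm.

Section RadialForm2.
Context {R : realType} {n : nat}.
Local Notation Hn := (Hn R n).
Local Notation form := (Defs.form R n).
Implicit Types (x a : Hn) (A B : 'I_(n + n)).

Lemma partialM (f g : Hn -> R) x l j :
  derivable f x (delta_mx l j) -> derivable g x (delta_mx l j) ->
  partial l j (f * g) x = f x * partial l j g x + g x * partial l j f x.
Proof. by move=> df dg; rewrite /partial (deriveM df dg) /GRing.scale/=. Qed.

Lemma cpartial_leibniz l j (g : Hn -> R) (h : Hn -> R[i]) x :
  derivable g x (delta_mx l j) ->
  derivable (@complex.Re R \o h) x (delta_mx l j) ->
  derivable (@complex.Im R \o h) x (delta_mx l j) ->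
  cpartial l j (fun y => (g y)%:C * h y) x =
  cpartial l j (fun y => (g y)%:C) x * h x + (g x)%:C * cpartial l j h x.
Proof.
move=> dg dr di; rewrite /cpartial.
rewrite (_ : @complex.Re R \o (fun y => _ * h y) = g * (@complex.Re R \o h)); last first.
  apply/funext => y; rewrite -[RHS]/(g y * complex.Re (h y)) /=.
  by case: (h y) => c d /=; rewrite mul0r subr0.
rewrite (_ : @complex.Im R \o (fun y => _ * h y) = g * (@complex.Im R \o h)); last first.
  apply/funext => y; rewrite -[RHS]/(g y * complex.Im (h y)) /=.
  by case: (h y) => c d /=; rewrite mul0r addr0.
rewrite (_ : @complex.Re R \o (fun y => (g y)%:C) = g)//.
rewrite (_ : @complex.Im R \o (fun y => (g y)%:C) = cst 0)//.
have -> : partial l j (cst 0 : Hn -> R) x = 0 by apply: partialE; exact: is_derive_cst.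
rewrite (partialM dg dr) (partialM dg di) /=.
by case: (h x) => c d; simpc => /=; congr (_ +i* _); ring.
Qed.

Lemma nabla_leibniz A alpha (g : Hn -> R) (h : Hn -> R[i]) x :
  (forall l j, derivable g x (delta_mx l j)) ->
  (forall l j, derivable (@complex.Re R \o h) x (delta_mx l j)) ->
  (forall l j, derivable (@complex.Im R \o h) x (delta_mx l j)) ->
  nabla A alpha (fun y => (g y)%:C * h y) x =
  nabla A alpha (fun y => (g y)%:C) x * h x + (g x)%:C * nabla A alpha h x.
Proof.
move=> dg dr di; rewrite /nabla.
have E l j := cpartial_leibniz (dg l j) (dr l j) (di l j).
have Hp (c d p q r s i : R[i]) : p * c + d * q + i * (r * c + d * s) =
  (p + i * r) * c + d * (q + i * s) by ring.
have Hm (c d p q r s i : R[i]) : p * c + d * q - i * (r * c + d * s) =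
  (p - i * r) * c + d * (q - i * s) by ring.
have Hn (c d p q r s i : R[i]) : - (p * c + d * q) - i * (r * c + d * s) =
  (- p - i * r) * c + d * (- q - i * s) by ring.
case: fintype.split => l; case: ifP => _; rewrite (E l) (E l).
- exact: Hp.
- exact: Hn.
- exact: Hm.
- exact: Hm.
Qed.

Lemma is_derive_affine (c : R) a x v l j :
  is_derive x v (fun y : Hn => c * (y l j - a l j)) (c * v l j).
Proof.
have h := is_derive_coord x v l j.
have -> : (fun y : Hn => c * (y l j - a l j)) =
   cst c * ((fun y : Hn => y l j) - cst (a l j)) by [].
by apply: is_derive_eq; rewrite subr0 scaler0 addr0.
Qed.

Lemma derivable_affine (c : R) a x v l j :
  derivable (fun y : Hn => c * (y l j - a l j)) x v.
Proof. by have [] := is_derive_affine c a x v l j. Qed.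

Let Re_grad a B : exists c l j,
  (@complex.Re R \o (grad_sqdist a 1 ^~ B)) = (fun y : Hn => c * (y l j - a l j)).
Proof.
rewrite /grad_sqdist; case: fintype.split => l /=.
  by exists (-2), l, 2%:R; apply/funext => y /=; rewrite mulNr.
by exists 2, l, 0.
Qed.

Let Im_grad a B : exists c l j,
  (@complex.Im R \o (grad_sqdist a 1 ^~ B)) = (fun y : Hn => c * (y l j - a l j)).
Proof.
rewrite /grad_sqdist; case: fintype.split => l /=.
  by exists (-2), l, 3%:R; apply/funext => y /=; rewrite mulNr.
by exists (-2), l, 1; apply/funext => y /=; rewrite mulNr.
Qed.

Lemma cpartial_grad_inl l j a l' x :
  cpartial l j (grad_sqdist a 1 ^~ (lshift n l')) x =
  (- 2 * ((l' == l) && (j == 2%:R))%:R) +i* (- 2 * ((l' == l) && (j == 3%:R))%:R).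
Proof.
rewrite /grad_sqdist (_ : fintype.split _ = inl l'); last exact: (unsplitK (inl l')).
apply: cpartial_derive => /=.
  rewrite (_ : _ \o _ = (fun y : Hn => - 2 * (y l' 2%:R - a l' 2%:R))); last first.
    by apply/funext => y /=; rewrite mulNr.
  by apply: is_derive_eq; [exact: is_derive_affine|rewrite mxE (eq_sym j)].
rewrite (_ : _ \o _ = (fun y : Hn => - 2 * (y l' 3%:R - a l' 3%:R))); last first.
  by apply/funext => y /=; rewrite mulNr.
by apply: is_derive_eq; [exact: is_derive_affine|rewrite mxE (eq_sym j)].
Qed.

Lemma cpartial_grad_inr l j a l' x :
  cpartial l j (grad_sqdist a 1 ^~ (rshift n l')) x =
  (2 * ((l' == l) && (j == 0))%:R) +i* (- 2 * ((l' == l) && (j == 1))%:R).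
Proof.
rewrite /grad_sqdist (_ : fintype.split _ = inr l'); last exact: (unsplitK (inr l')).
apply: cpartial_derive => /=.
  rewrite (_ : _ \o _ = (fun y : Hn => 2 * (y l' 0 - a l' 0)))//.
  by apply: is_derive_eq; [exact: is_derive_affine|rewrite mxE (eq_sym j)].
rewrite (_ : _ \o _ = (fun y : Hn => - 2 * (y l' 1 - a l' 1))); last first.
  by apply/funext => y /=; rewrite mulNr.
by apply: is_derive_eq; [exact: is_derive_affine|rewrite mxE (eq_sym j)].
Qed.

(** That is, Delta of the squared distance is 8 beta_n. *)
Lemma sum_hessian_sqdist a x :
  \sum_B \sum_A nabla A 0 (grad_sqdist a 1 ^~ B) x *: (omega1 A * omega1 B) =
  8%:R *: beta_n :> form.
Proof.
have El l l' : nabla (lshift n l) 0 (grad_sqdist a 1 ^~ (lshift n l')) x = 0.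
  rewrite /nabla (_ : fintype.split _ = inl l); last exact: (unsplitK (inl l)).
  rewrite /= !cpartial_grad_inl !andbF; apply/eqP; rewrite eq_complex /=.
  by apply/andP; split; apply/eqP; ring.
have Er l l' : nabla (rshift n l) 0 (grad_sqdist a 1 ^~ (rshift n l')) x = 0.
  rewrite /nabla (_ : fintype.split _ = inr l); last exact: (unsplitK (inr l)).
  rewrite /= !cpartial_grad_inr !andbF; apply/eqP; rewrite eq_complex /=.
  by apply/andP; split; apply/eqP; ring.
have Elr l l' : nabla (lshift n l) 0 (grad_sqdist a 1 ^~ (rshift n l')) x =
    4%:R * (l' == l)%:R.
  rewrite /nabla (_ : fintype.split _ = inl l); last exact: (unsplitK (inl l)).
  rewrite /= !cpartial_grad_inr !andbF !andbT.
  by case: (l' == l); apply/eqP; rewrite eq_complex /=; apply/andP; split; apply/eqP; ring.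
have Erl l l' : nabla (rshift n l) 0 (grad_sqdist a 1 ^~ (lshift n l')) x =
    - (4%:R * (l' == l)%:R).
  rewrite /nabla (_ : fintype.split _ = inr l); last exact: (unsplitK (inr l)).
  rewrite /= !cpartial_grad_inl !andbF !andbT.
  by case: (l' == l); apply/eqP; rewrite eq_complex /=; apply/andP; split; apply/eqP; ring.
have S (f : 'I_n -> form) l' (c : R[i]) : \sum_l (c * (l' == l)%:R) *: f l = c *: f l'.
  rewrite (bigD1 l')//= eqxx mulr1 big1 ?addr0// => l /negbTE ll'.
  by rewrite eq_sym ll' mulr0 scale0r.
rewrite big_split_ord/=.
under eq_bigr => l' _.
  rewrite big_split_ord/= big1 => [|l _]; last by rewrite El scale0r.
  under eq_bigr => l _ do rewrite Erl -mulNr.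
  rewrite S add0r omega1_anticomm scaleNr scalerN opprK.
  over.
under [X in _ + X]eq_bigr => l' _.
  rewrite big_split_ord/= addrC big1 => [|l _]; last by rewrite Er scale0r.
  under eq_bigr => l _ do rewrite Elr.
  rewrite S add0r.
  over.
rewrite -big_split/= /beta_n scaler_sumr; apply: eq_bigr => l _.
by rewrite -scalerDl -natrD.
Qed.

(** The form d_0 P /\ d_1 P, where P is the squared distance to a. *)
Definition radial_form a x : form :=
  covector (grad_sqdist a 0 x) * covector (grad_sqdist a 1 x).

Lemma Delta_radial a (phi dphi ddphi : R -> R) x :
  (forall t : R, 0 <= t -> is_derive t (1 : R) phi (dphi t)) ->
  (forall t : R, 0 <= t -> is_derive t (1 : R) dphi (ddphi t)) ->
  Delta (phi \o sqdist a) x =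
  (8 * dphi (sqdist a x))%:C *: beta_n + (ddphi (sqdist a x))%:C *: radial_form a x.
Proof.
move=> h1 h2; rewrite /Delta.
rewrite (_ : dform 1 _ = fun y => covector (fun A =>
    (dphi (sqdist a y))%:C * grad_sqdist a 1 y A)); last first.
  apply/funext => y; rewrite dform_function; apply: eq_bigr => A _.
  by rewrite (nabla_radial _ _ _ _ h1).
rewrite dform_covector.
have E A B : nabla A 0 (fun y => (dphi (sqdist a y))%:C * grad_sqdist a 1 y B) x =
    (ddphi (sqdist a x))%:C * (grad_sqdist a 0 x A * grad_sqdist a 1 x B)
    + (dphi (sqdist a x))%:C * nabla A 0 (grad_sqdist a 1 ^~ B) x.
  rewrite nabla_leibniz.
  - by rewrite (nabla_radial _ _ _ _ h2) mulrA.
  - by move=> l j; have [] := is_derive_sqdist_comp a l j x h2.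
  - by move=> l j; have [c [l' [j' ->]]] := Re_grad a B; exact: derivable_affine.
  - by move=> l j; have [c [l' [j' ->]]] := Im_grad a B; exact: derivable_affine.
under eq_bigr => B _ do under eq_bigr => A _ do rewrite E scalerDl -!scalerA.
under eq_bigr => B _ do rewrite big_split/= -!scaler_sumr.
rewrite big_split/= -!scaler_sumr sum_hessian_sqdist addrC; congr (_ + _).
  by rewrite scalerA rmorphM/= mulrC rmorph_nat.
congr (_ *: _); rewrite /radial_form /covector mulr_suml exchange_big/=.
apply: eq_bigr => A _; rewrite mulr_sumr; apply: eq_bigr => B _.
by rewrite -scalerAl -scalerAr scalerA.
Qed.

End RadialForm2.

Section FormIdentity.
Context {R : realType} {n : nat}.
Local Notation Hn := (Hn R n).
Local Notation form := (Defs.form R n).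

Lemma omega1_covector (A : 'I_(n + n)) :
  omega1 A = covector (fun B => (B == A)%:R) :> form.
Proof.
rewrite /covector (bigD1 A)//= eqxx scale1r big1 ?addr0// => B /negbTE ->.
by rewrite scale0r.
Qed.

Lemma beta_radial_comm (a x : Hn) : GRing.comm (beta_n : form) (radial_form a x).
Proof.
apply: commr_sym; apply: commr_sum => l _.
by rewrite wedgeE !omega1_covector; exact: covector2_comm.
Qed.

(** The hypotheses on dchi and ddchi say that chi' = (8 phi')^k psi' and that
    chi'' is given by the product rule. *)
Lemma radial_form_identity (a x : Hn) (k l : nat)
    (phi dphi ddphi psi dpsi ddpsi chi dchi ddchi : R -> R) :
  (forall t : R, 0 <= t -> is_derive t (1 : R) phi (dphi t)) ->
  (forall t : R, 0 <= t -> is_derive t (1 : R) dphi (ddphi t)) ->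
  (forall t : R, 0 <= t -> is_derive t (1 : R) psi (dpsi t)) ->
  (forall t : R, 0 <= t -> is_derive t (1 : R) dpsi (ddpsi t)) ->
  (forall t : R, 0 <= t -> is_derive t (1 : R) chi (dchi t)) ->
  (forall t : R, 0 <= t -> is_derive t (1 : R) dchi (ddchi t)) ->
  (forall t : R, 0 <= t -> dchi t = (8 * dphi t) ^+ k * dpsi t) ->
  (forall t : R, 0 <= t -> ddchi t = (8 * dphi t) ^+ k * ddpsi t
     + k%:R * (8 * dphi t) ^+ k.-1 * (8 * ddphi t) * dpsi t) ->
  wedge (\big[wedge/one_form]_(i < k) Delta (phi \o sqdist a) x)
    (wedge (wedge_pow beta_n l) (Delta (psi \o sqdist a) x)) =
  wedge (wedge_pow beta_n (k + l)) (Delta (chi \o sqdist a) x).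
Proof.
move=> h1 h2 h3 h4 h5 h6 E1 E2.
rewrite big_wedge !wedge_powE !wedgeE.
rewrite (Delta_radial _ _ h1 h2) (Delta_radial _ _ h3 h4) (Delta_radial _ _ h5 h6).
rewrite radial_product; [|exact: beta_radial_comm|exact: covector2_sqr].
rewrite E1 ?sqdist_ge0// E2 ?sqdist_ge0//.
set t := sqdist a x; congr (_ * (_ *: _ + _ *: _)).
  by rewrite -rmorphXn -rmorphM/=; congr (_%:C); ring.
rewrite -!rmorphXn -(rmorph_nat (real_complex R)) -!rmorphM -rmorphD/=.
by congr (_%:C); ring.
Qed.

End FormIdentity.

(** * Quaternionic matrices alpha I + b Y Y^* *)

Section Quaternions.
Context {R : realType}.
Local Notation H := (quat R).
Local Notation rq := (@quat_of_real R).
Implicit Types (x y : H) (c d : R).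

(** The squared norm of a quaternion. *)
Definition qnorm2 x : R := q0 x ^+ 2 + q1 x ^+ 2 + q2 x ^+ 2 + q3 x ^+ 2.

Lemma quat_eq x y :
  q0 x = q0 y -> q1 x = q1 y -> q2 x = q2 y -> q3 x = q3 y -> x = y.
Proof. by case: x y => ? ? ? ? [? ? ? ?] /= -> -> -> ->. Qed.

Lemma rqD c d : rq (c + d) = rq c + rq d.
Proof. by apply: quat_eq => /=; rewrite ?addr0. Qed.

Lemma rqN c : rq (- c) = - rq c.
Proof. by apply: quat_eq => /=; rewrite ?oppr0. Qed.

Lemma rqM c d : rq (c * d) = rq c * rq d.
Proof. by apply: quat_eq => /=; ring. Qed.

Lemma rq_sum (I : Type) (r : seq I) (P : pred I) (F : I -> R) :
  rq (\sum_(i <- r | P i) F i) = \sum_(i <- r | P i) rq (F i).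
Proof. exact: (big_morph rq rqD). Qed.

Lemma rq_inj : injective rq.
Proof. by move=> c d []. Qed.

Lemma rqC c x : rq c * x = x * rq c.
Proof. by apply: quat_eq => /=; ring. Qed.

Lemma qconjD x y : qconj (x + y) = qconj x + qconj y.
Proof. by apply: quat_eq => /=; ring. Qed.

Lemma qconjM x y : qconj (x * y) = qconj y * qconj x.
Proof. by apply: quat_eq => /=; ring. Qed.

Lemma qconjK x : qconj (qconj x) = x.
Proof. by apply: quat_eq => /=; ring. Qed.

Lemma qconj_rq c : qconj (rq c) = rq c.
Proof. by apply: quat_eq => /=; ring. Qed.

Lemma qconj_sum (I : Type) (r : seq I) (P : pred I) (F : I -> H) :
  qconj (\sum_(i <- r | P i) F i) = \sum_(i <- r | P i) qconj (F i).
Proof. by apply: (big_morph qconj qconjD); exact: qconj_rq. Qed.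

Lemma mulq_conj x : x * qconj x = rq (qnorm2 x).
Proof. by apply: quat_eq => /=; rewrite /qnorm2; ring. Qed.

Lemma mul_conjq x : qconj x * x = rq (qnorm2 x).
Proof. by apply: quat_eq => /=; rewrite /qnorm2; ring. Qed.

Lemma qnorm2_ge0 x : 0 <= qnorm2 x.
Proof. by rewrite /qnorm2 !addr_ge0 ?sqr_ge0. Qed.

Lemma qnorm2_eq0 x : (qnorm2 x == 0) = (x == 0).
Proof.
apply/eqP/eqP => [|->]; last by rewrite /qnorm2 /= !expr0n /= !addr0.
rewrite /qnorm2 => /eqP; rewrite !paddr_eq0 ?addr_ge0 ?sqr_ge0// !sqrf_eq0.
by move=> /andP[/andP[/andP[/eqP a0 /eqP a1] /eqP a2] /eqP a3]; exact: quat_eq.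
Qed.

Lemma qnorm2_0 : qnorm2 (0 : H) = 0.
Proof. by apply/eqP; rewrite qnorm2_eq0. Qed.

Lemma qnorm2M x y : qnorm2 (x * y) = qnorm2 x * qnorm2 y.
Proof. by rewrite /qnorm2 /=; ring. Qed.

Lemma qnorm2_conj x : qnorm2 (qconj x) = qnorm2 x.
Proof. by rewrite /qnorm2 /=; ring. Qed.

Lemma qnorm2_rq c : qnorm2 (rq c) = c ^+ 2.
Proof. by rewrite /qnorm2 /=; ring. Qed.

(** The conjugate transpose of a rectangular matrix; [adjm] and [adjq] agree, by
    definition, on square matrices. *)
Definition adjm {p q} (A : 'M[H]_(p, q)) : 'M[H]_(q, p) :=
  \matrix_(i, j) qconj (A j i).

Lemma adjmM p q r (A : 'M[H]_(p, q)) (B : 'M[H]_(q, r)) :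
  adjm (A *m B) = adjm B *m adjm A.
Proof.
apply/matrixP => i j; rewrite !mxE qconj_sum; apply: eq_bigr => k _.
by rewrite !mxE qconjM.
Qed.

Lemma adjmK p q (A : 'M[H]_(p, q)) : adjm (adjm A) = A.
Proof. by apply/matrixP => i j; rewrite !mxE qconjK. Qed.

Lemma adjmD p q (A B : 'M[H]_(p, q)) : adjm (A + B) = adjm A + adjm B.
Proof. by apply/matrixP => i j; rewrite !mxE qconjD. Qed.

Lemma adjm_rq p q c (A : 'M[H]_(p, q)) : adjm (rq c *: A) = rq c *: adjm A.
Proof. by apply/matrixP => i j; rewrite !mxE qconjM qconj_rq rqC. Qed.

Lemma adjm1 p : adjm (1%:M : 'M[H]_p) = 1%:M.
Proof.
apply/matrixP => i j; rewrite !mxE eq_sym; case: (i == j) => /=.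
  exact: (qconj_rq 1).
exact: (qconj_rq 0).
Qed.

Lemma mulmx_rq p q r c (A : 'M[H]_(p, q)) (B : 'M[H]_(q, r)) :
  A *m (rq c *: B) = rq c *: (A *m B).
Proof.
apply/matrixP => i j; rewrite !mxE mulr_sumr; apply: eq_bigr => k _.
by rewrite !mxE mulrA -rqC mulrA.
Qed.

Section RankOne.
Variable n : nat.
Implicit Types (Y Z W : 'cV[H]_n.+1) (U : 'M[H]_n.+1).

(** The squared norm of a column vector. *)
Definition vnorm2 Y : R := \sum_l qnorm2 (Y l 0).

Lemma adjm_mul_self Y : adjm Y *m Y = rq (vnorm2 Y) *: 1%:M.
Proof.
apply/matrixP => i j; rewrite !ord1 !mxE eqxx mulr1 rq_sum.
by apply: eq_bigr => k _; rewrite mxE mul_conjq.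
Qed.

(** The quaternionic Householder reflection. *)
Lemma unitary_householder Z (N : R) : N != 0 -> vnorm2 Z = N ->
  unitary (1%:M - rq (2 / N) *: (Z *m adjm Z)).
Proof.
move=> N0 ZN; set U := _ - _.
have aU : adjm U = U.
  rewrite /U -scaleN1r adjmD adjm1; congr (_ + _).
  by rewrite scalerA -[-1 : H]/(- rq 1) -rqN -rqM adjm_rq adjmM adjmK.
have UU : U *m U = 1%:M.
  rewrite /U mulmxBl mul1mx mulmxBr mulmx1 -scalemxAl mulmx_rq.
  have -> : Z *m adjm Z *m (Z *m adjm Z) = rq N *: (Z *m adjm Z).
    rewrite mulmxA -(mulmxA Z) adjm_mul_self ZN mulmx_rq mulmx1.
    by rewrite -scalemxAl.
  rewrite !scalerA -!rqM -!scalerBl.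
  have -> : 2 / N * (2 / N * N) = 2 / N + 2 / N by field.
  by rewrite rqD opprD addrA subrr sub0r scaleNr opprK subrK.
by split; rewrite -[adjq U]/(adjm U) aU.
Qed.

Lemma vnorm2_split Y j0 :
  vnorm2 Y = qnorm2 (Y j0 0) + \sum_(j | j != j0) qnorm2 (Y j 0).
Proof. by rewrite /vnorm2 (bigD1 j0). Qed.

Local Notation e0 := (delta_mx 0 0 : 'cV[H]_n.+1).

(** The reflection of axis Y + e0 sends e0 to - Y because the first coordinate r
    of Y is real; r >= 0 keeps Y + e0 away from 0. *)
Lemma unitary_first_column Y (r : R) :
  vnorm2 Y = 1 -> Y 0 0 = rq r -> 0 <= r ->
  exists2 U, unitary U & U *m e0 = - Y.
Proof.
move=> Y1 Yr r0; pose Z := Y + e0.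
have Z0 : Z 0 0 = rq (r + 1) by rewrite !mxE Yr rqD.
have NZ : vnorm2 Z = 2 * (r + 1).
  rewrite (vnorm2_split Z 0) Z0 qnorm2_rq.
  under eq_bigr => j /negbTE j0 do rewrite !mxE j0 addr0.
  have -> : \sum_(j | j != 0) qnorm2 (Y j 0) = 1 - r ^+ 2.
    by apply/eqP; rewrite eq_sym subr_eq -Y1 (vnorm2_split Y 0) Yr qnorm2_rq addrC.
  by ring.
have r1 : r + 1 != 0 by rewrite gt_eqF// ltr_wpDl.
have N0 : 2 * (r + 1) != 0 by rewrite mulf_neq0.
exists (1%:M - rq (2 / (2 * (r + 1))) *: (Z *m adjm Z)).
  exact: unitary_householder NZ.
rewrite mulmxBl mul1mx -scalemxAl -mulmxA.
have -> : adjm Z *m e0 = rq (r + 1) *: 1%:M.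
  apply/matrixP => i j; rewrite !ord1 !mxE eqxx mulr1 (bigD1 0)//= big1.
    by rewrite [X in _ * X]mxE eqxx mulr1 addr0 [LHS]mxE Z0 qconj_rq.
  by move=> k /negbTE k0; rewrite [X in _ * X]mxE k0 mulr0.
rewrite mulmx_rq mulmx1 scalerA -rqM.
have -> : 2 / (2 * (r + 1)) * (r + 1) = 1 by field.
by rewrite scale1r /Z opprD addrCA subrr addr0.
Qed.

(** Replacing Y by Y x divides Y Y^* by |Y|^2 and makes the first coordinate
    real and nonnegative. *)
Lemma normalizing_factor Y (N : R) : 0 < N -> vnorm2 Y = N ->
  exists x, qnorm2 x = N^-1 /\ exists2 r, Y 0 0 * x = rq r & 0 <= r.
Proof.
move=> N0 YN; have [Y0|Y0] := eqVneq (Y 0 0) 0.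
  exists (rq (Num.sqrt N)^-1); split.
    by rewrite qnorm2_rq exprVn sqr_sqrtr// ltW.
  by exists 0 => //; rewrite Y0 mul0r.
set q := qnorm2 (Y 0 0).
have q_gt0 : 0 < q by rewrite lt_neqAle qnorm2_ge0 eq_sym qnorm2_eq0 Y0.
exists (rq (Num.sqrt (q * N))^-1 * qconj (Y 0 0)); split.
  rewrite qnorm2M qnorm2_rq qnorm2_conj exprVn sqr_sqrtr ?mulr_ge0 ?ltW//.
  by rewrite -/q; field; rewrite !gt_eqF.
exists (q * (Num.sqrt (q * N))^-1).
  by rewrite mulrA -rqC -mulrA mulq_conj -rqM mulrC.
by rewrite mulr_ge0 ?invr_ge0 ?sqrtr_ge0// ltW.
Qed.

(** The hyperhermitian matrix alpha I + b Y Y^*. *)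
Definition rank_one (alpha b : R) Y : 'M[H]_n.+1 :=
  rq alpha *: 1%:M + rq b *: (Y *m adjm Y).

Lemma diag_rank_one (alpha c : R) :
  diag_mx (map_mx rq (\row_j (if j == 0 then alpha + c else alpha))) =
  rank_one alpha c e0.
Proof.
apply/matrixP => i j; rewrite !mxE big_ord1 !mxE eqxx andbT.
have q10 : qconj (1 : H) = 1 by exact: (qconj_rq 1).
have q00 : qconj (0 : H) = 0 by exact: (qconj_rq 0).
have -> : qconj ((j == 0) && true)%:R = (j == 0)%:R :> H by case: (j == 0).
have [<-|ij] := eqVneq i j.
  by case: (i == 0); rewrite /= ?mulr1n ?mulr1 ?mulr0 ?addr0 ?rqD.
have : ~~ ((i == 0) && (j == 0)).
  by apply: contra ij => /andP[/eqP -> /eqP ->].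
by case: (i == 0); case: (j == 0) => //= _; rewrite mulr0n ?mulr0 ?mul0r ?mulr0 addr0.
Qed.

Lemma rank_one_conj (alpha b : R) Y U : unitary U ->
  U *m rank_one alpha b Y *m adjq U = rank_one alpha b (U *m Y).
Proof.
move=> [UU _]; rewrite /rank_one mulmxDr mulmxDl !mulmx_rq mulmx1 -!scalemxAl UU.
by rewrite adjmM !mulmxA.
Qed.

Lemma rank_one_diagonalizable (alpha b : R) Y : exists U (lambda : 'rV[R]_n.+1),
  unitary U /\ rank_one alpha b Y = U *m diag_mx (map_mx rq lambda) *m adjq U.
Proof.
have [Y0|Y0] := eqVneq (vnorm2 Y) 0.
  exists 1%:M, (const_mx alpha).
  have Yl l : Y l 0 = 0.
    apply/eqP; rewrite -qnorm2_eq0.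
    move/eqP: Y0; rewrite (vnorm2_split Y l) paddr_eq0 ?qnorm2_ge0//.
      by case/andP.
    by apply: sumr_ge0 => j _; exact: qnorm2_ge0.
  split; first by split; rewrite -[adjq _]/(adjm _) adjm1 mulmx1.
  rewrite -[adjq _]/(adjm _) adjm1 mulmx1 mul1mx.
  apply/matrixP => i j; rewrite !mxE big_ord1 Yl mul0r mulr0 addr0.
  by case: eqP => _; rewrite ?mulr1n ?mulr0n ?mulr1 ?mulr0.
have N0 : 0 < vnorm2 Y.
  by rewrite lt_neqAle eq_sym Y0 sumr_ge0// => l _; exact: qnorm2_ge0.
have [x [xN [r Yr r0]]] := normalizing_factor N0 erefl.
pose Y' : 'cV[H]_n.+1 := \col_l (Y l 0 * x).
have Y'1 : vnorm2 Y' = 1.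
  rewrite /vnorm2; under eq_bigr => l _ do rewrite mxE qnorm2M.
  by rewrite -mulr_suml xN mulfV.
have Y'r : Y' 0 0 = rq r by rewrite mxE.
have [U uU Ue] := unitary_first_column Y'1 Y'r r0.
exists U, (\row_j (if j == 0 then alpha + b * vnorm2 Y else alpha)).
split; first exact: uU.
rewrite diag_rank_one (rank_one_conj _ _ _ uU) Ue /rank_one.
suff -> : rq (b * vnorm2 Y) *: (- Y' *m adjm (- Y')) = rq b *: (Y *m adjm Y) by [].
apply/matrixP => i j; rewrite !mxE !big_ord1 !mxE.
have -> : - (Y i 0 * x) * qconj (- (Y j 0 * x)) = Y i 0 * (x * qconj x) * qconj (Y j 0).
  have -> : qconj (- (Y j 0 * x)) = - (qconj x * qconj (Y j 0)).
    by rewrite -qconjM; apply: quat_eq => /=; ring.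
  by rewrite mulrNN !mulrA.
by rewrite mulq_conj xN -rqC -[in LHS]mulrA mulrA -rqM -mulrA mulfV// mulr1.
Qed.

(** The diagonal matrix of lambda is alpha I + b W W^*, where W = U^* Y. If
    b != 0, then W has at most one nonzero entry, since the off-diagonal entries
    b W_i W_j^* vanish; this entry carries the whole norm of Y. *)
Lemma rank_one_eigenvalues (alpha b : R) Y U (lambda : 'rV[R]_n.+1) :
  unitary U -> rank_one alpha b Y = U *m diag_mx (map_mx rq lambda) *m adjq U ->
  exists j0, forall j,
    lambda 0 j = if j == j0 then alpha + b * vnorm2 Y else alpha.
Proof.
move=> uU E; have [UU UU'] := uU.
have uU' : unitary (adjm U).
  by split; rewrite -[adjq _]/(adjm _) adjmK.
pose W := adjm U *m Y.
have D : diag_mx (map_mx rq lambda) = rank_one alpha b W.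
  rewrite -rank_one_conj// E -[adjq (adjm U)]/(adjm (adjm U)) adjmK.
  by rewrite -!mulmxA UU' mulmx1 mulmxA UU' mul1mx.
have WN : vnorm2 W = vnorm2 Y.
  apply: rq_inj.
  have /matrixP/(_ 0 0) := adjm_mul_self W.
  rewrite /W adjmM adjmK -mulmxA (mulmxA U) UU mul1mx adjm_mul_self.
  by rewrite !mxE !mulr1.
clearbody W.
have dE j : lambda 0 j = alpha + b * qnorm2 (W j 0).
  apply: rq_inj; have /matrixP/(_ j j) := D.
  rewrite !mxE eqxx big_ord1 mulr1n mulr1 => ->.
  by rewrite mxE mulq_conj rqD rqM.
have [b0|b0] := eqVneq b 0.
  by exists 0 => j; rewrite dE b0 !mul0r addr0 if_same.
have oE i j : i != j -> W i 0 = 0 \/ W j 0 = 0.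
  move=> ij; have /matrixP/(_ i j) := D.
  rewrite !mxE (negbTE ij) mulr0n big_ord1 mulr0 add0r mxE => /esym/(congr1 qnorm2).
  rewrite !qnorm2M qnorm2_rq qnorm2_conj => /eqP.
  rewrite qnorm2_0 !mulf_eq0 (negbTE b0) /= !qnorm2_eq0.
  by case/orP => /eqP; [left|right].
have [[j0 /eqP Wj0]|W0] := pselect (exists j, W j 0 <> 0).
  have W0 j : j != j0 -> W j 0 = 0.
    by move=> jj0; case: (oE _ _ jj0) => // h; rewrite h eqxx in Wj0.
  exists j0 => j; rewrite dE; case: eqP => [->|/eqP jj0].
    rewrite -WN (vnorm2_split W j0) big1 ?addr0// => i ij0.
    by apply/eqP; rewrite qnorm2_eq0 W0.
  by rewrite W0// qnorm2_0 mulr0 addr0.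
have W0' j : qnorm2 (W j 0) = 0.
  by apply/eqP; rewrite qnorm2_eq0; apply: contra_notT W0 => /eqP Wj; exists j.
exists 0 => j; rewrite dE -WN /vnorm2 big1 => [|i _]; last exact: W0'.
by rewrite W0' mulr0 addr0 if_same.
Qed.

End RankOne.
End Quaternions.

(** * Radial functions that are m-subharmonic *)

Section HessianRadial.
Context {R : realType}.
Local Notation H := (quat R).
Local Notation rq := (@quat_of_real R).

Lemma elem_sym_two_values (n m : nat) (alpha gamma : R) (j0 : 'I_n.+1)
    (lambda : 'rV[R]_n.+1) :
  (forall j, lambda 0 j = if j == j0 then gamma else alpha) ->
  elem_sym m.+1 lambda =
  'C(n, m.+1)%:R * alpha ^+ m.+1 + 'C(n, m)%:R * (alpha ^+ m * gamma).
Proof.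
move=> E; rewrite /elem_sym (bigID (fun J : {set 'I_n.+1} => j0 \notin J))/=.
(* There are 'C(n, m.+1) sets of size m.+1 avoiding j0, and by Pascal's rule
   'C(n, m) sets of size m.+1 containing it. *)
have cN : #|[set J : {set 'I_n.+1} | (#|J| == m.+1) && (j0 \notin J)]%SET| = 'C(n, m.+1).
  rewrite -[in RHS](_ : #|(~: [set j0])%SET| = n); last first.
    by rewrite finset.cardsCs finset.setCK cards1 card_ord subn1.
  rewrite -cards_draws; apply: eq_card => J; rewrite !inE andbC; congr andb.
  by rewrite finset.subsetC finset.sub1set inE.
have cT : (#|[set J : {set 'I_n.+1} | (#|J| == m.+1) && (j0 \notin J)]%SET| +
    #|[set J : {set 'I_n.+1} | (#|J| == m.+1) && ~~ (j0 \notin J)]%SET|)%N = 'C(n.+1, m.+1).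
  rewrite -[n.+1 in RHS]card_ord -card_draws -finset.cardsUI addnC.
  rewrite (_ : (_ :&: _)%SET = finset.set0) ?cards0 ?add0n; last first.
    by apply/setP => J; rewrite !inE; case: (#|J| == m.+1); case: (j0 \in J).
  apply: eq_card => J; rewrite !inE -andb_orr.
  by case: (j0 \in J); rewrite andbT.
have cP : #|[set J : {set 'I_n.+1} | (#|J| == m.+1) && ~~ (j0 \notin J)]%SET| = 'C(n, m).
  by move: cT; rewrite cN binS => /eqP; rewrite eqn_add2l => /eqP.
congr (_ + _).
  rewrite (eq_bigr (fun=> alpha ^+ m.+1)) => [|J /andP[/eqP Jm j0J]]; last first.
    rewrite (eq_bigr (fun=> alpha)); last first.
      by move=> j jJ; rewrite E (_ : j == j0 = false)//; apply: contraNF j0J => /eqP <-.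
    by rewrite prodr_const Jm.
  rewrite sumr_const -cN; rewrite -[LHS]mulr_natl; congr (_%:R * _).
  by apply: eq_card => J; rewrite inE.
rewrite (eq_bigr (fun=> alpha ^+ m * gamma)) => [|J /andP[/eqP Jm]]; last first.
  rewrite negbK => j0J; rewrite (bigD1 j0)//= E eqxx mulrC; congr (_ * _).
  rewrite (eq_bigr (fun=> alpha)) => [|j /andP[jJ /negbTE jj0]]; last by rewrite E jj0.
  rewrite (eq_bigl (mem (J :\ j0)%SET)) => [|i]; last by rewrite !inE andbC.
  rewrite prodr_const; congr (_ ^+ _).
  by move: Jm; rewrite (finset.cardsD1 j0) j0J => -[].
rewrite sumr_const -cP -[LHS]mulr_natl; congr (_%:R * _).
by apply: eq_card => J; rewrite inE.
Qed.

(** The (m+1)-st elementary symmetric function of n copies of alpha and one copy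
    of alpha + c is alpha^m ((n+1) alpha + (m+1) c) 'C(n, m) / (m+1). *)
Lemma elem_sym_pos (n m : nat) (alpha c : R) (j0 : 'I_n.+1) (lambda : 'rV[R]_n.+1) :
  (m <= n)%N -> 0 < alpha -> 0 < n.+1%:R * alpha + m.+1%:R * c ->
  (forall j, lambda 0 j = if j == j0 then alpha + c else alpha) ->
  0 < elem_sym m.+1 lambda.
Proof.
move=> mn alpha0 pos E; rewrite (elem_sym_two_values m E).
have m0 : 0 < m.+1%:R :> R by [].
rewrite -(pmulr_rgt0 _ m0).
have -> : m.+1%:R * ('C(n, m.+1)%:R * alpha ^+ m.+1 + 'C(n, m)%:R * (alpha ^+ m * (alpha + c))) =
    'C(n, m)%:R * alpha ^+ m * (n.+1%:R * alpha + m.+1%:R * c).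
  have -> : m.+1%:R * ('C(n, m.+1)%:R * alpha ^+ m.+1 + 'C(n, m)%:R * (alpha ^+ m * (alpha + c))) =
    (m.+1 * 'C(n, m.+1))%:R * alpha ^+ m.+1 + m.+1%:R * 'C(n, m)%:R * (alpha ^+ m * (alpha + c)).
    by rewrite natrM; ring.
  rewrite mul_bin_left natrM natrB// exprS -[n.+1]addn1 -[m.+1]addn1 !natrD.
  by ring.
by rewrite !mulr_gt0 ?exprn_gt0// ltr0n bin_gt0.
Qed.

Lemma rank_one_Gamma (n m : nat) (alpha b : R) (Y : 'cV[H]_n.+1) :
  (m <= n)%N -> 0 < alpha -> 0 < n.+1%:R * alpha + m.+1%:R * (b * vnorm2 Y) ->
  Gamma m.+1 (rank_one alpha b Y).
Proof.
move=> mn alpha0 pos; split.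
  rewrite /hyperhermitian -[adjq _]/(adjm _) /rank_one adjmD !adjm_rq adjm1.
  by rewrite adjmM adjmK.
move=> s s0.
have -> : (rq s)%:M + rank_one alpha b Y = rank_one (s + alpha) b Y.
  by rewrite /rank_one rqD scalerDl addrA -[(rq s)%:M]scalemx1.
rewrite /sym_eigen; set S := [set h | _].
have [U0 [lambda0 [uU0 E0]]] := rank_one_diagonalizable (s + alpha) b Y.
have : S (xget 0 S).
  by apply: xgetPex; exists (elem_sym m.+1 lambda0), U0, lambda0.
move=> [U [lambda [uU E ->]]].
have [j0 j0E] := rank_one_eigenvalues uU E.
apply: (elem_sym_pos mn _ _ j0E); first by rewrite ltr_wpDl.
by rewrite mulrDr -addrA ltr_wpDl// mulr_ge0.
Qed.

Section Hessian.
Variable n : nat.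
Local Notation Hn := (Hn R n).
Implicit Types (a x : Hn).

(** The vector x - a of H^n, as a column of quaternions. *)
Definition quat_col a x : 'cV[H]_n :=
  \col_l Quat (x l 0 - a l 0) (x l 1 - a l 1) (x l 2%:R - a l 2%:R) (x l 3%:R - a l 3%:R).

Lemma sqdist_qnorm2 a x : sqdist a x = \sum_l qnorm2 (quat_col a x l 0).
Proof.
apply: eq_bigr => l _; rewrite !mxE /qnorm2/= !big_ord_recr big_ord0/= add0r.
by do 3?congr (_ + _); congr ((x _ _ - a _ _) ^+ _); apply: val_inj.
Qed.

Lemma d_dq_radial a (phi dphi : R -> R) k x :
  (forall t : R, 0 <= t -> is_derive t (1 : R) phi (dphi t)) ->
  d_dq k (rq \o (phi \o sqdist a)) x =
  rq (2 * dphi (sqdist a x)) * qconj (quat_col a x k 0).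
Proof.
move=> h; rewrite /d_dq /qpartial.
have E (c : R) j : partial k j (fun=> c) x = 0.
  by apply: partialE; exact: is_derive_cst.
have P j := partialE (is_derive_sqdist_comp a k j x h).
by rewrite mxE; apply: quat_eq => /=; rewrite ?P ?E; ring.
Qed.

Lemma quat_hessian_radial a (phi dphi ddphi : R -> R) x :
  (forall t : R, 0 <= t -> is_derive t (1 : R) phi (dphi t)) ->
  (forall t : R, 0 <= t -> is_derive t (1 : R) dphi (ddphi t)) ->
  quat_hessian (phi \o sqdist a) x =
  rq (8 * dphi (sqdist a x)) *: 1%:M +
  rq (4 * ddphi (sqdist a x)) *: (quat_col a x *m adjm (quat_col a x)).
Proof.
move=> h1 h2; apply/matrixP => l k; rewrite !mxE big_ord1.
rewrite (_ : d_dq k _ = fun y => rq (2 * dphi (sqdist a y)) * qconj (quat_col a y k 0)); last first.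
  by apply/funext => y; rewrite (d_dq_radial _ _ _ h1).
(* The components of d_dq k are the functions f below, with c = 1 or -1. *)
have P (f : Hn -> R) c j i :
    (forall y, f y = 2 * dphi (sqdist a y) * (c * (y k i - a k i))) -> partial l j f x =
    4 * ddphi (sqdist a x) * (x l j - a l j) * (c * (x k i - a k i))
    + 2 * dphi (sqdist a x) * c * ((l == k) && (j == i))%:R.
  move=> /funext ->.
  pose F : Hn -> R := fun y => 2 * dphi (sqdist a y).
  pose G : Hn -> R := fun y => c * (y k i - a k i).
  have dF : is_derive x (delta_mx l j) F (2 * (ddphi (sqdist a x) * (2 * (x l j - a l j)))).
    have hh := is_derive_sqdist_comp a l j x h2.
    have -> : F = cst 2 * (dphi \o sqdist a) by [].
    by apply: is_derive_eq; rewrite scaler0 addr0.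
  have dG : is_derive x (delta_mx l j) G (c * ((l == k) && (j == i))%:R).
    by apply: is_derive_eq; [exact: is_derive_affine|rewrite mxE (eq_sym k) (eq_sym i)].
  have [eF _] := dF; have [eG _] := dG.
  have := partialM eF eG; rewrite (partialE dF) (partialE dG) /F /G => ->.
  by ring.
have E0 j : partial l j
    (@q0 R \o (fun y => rq (2 * dphi (sqdist a y)) * qconj (quat_col a y k 0))) x =
    4 * ddphi (sqdist a x) * (x l j - a l j) * (1 * (x k 0 - a k 0))
    + 2 * dphi (sqdist a x) * 1 * ((l == k) && (j == 0))%:R.
  by apply: P => y; rewrite /= mxE /=; ring.
have E1 j : partial l j
    (@q1 R \o (fun y => rq (2 * dphi (sqdist a y)) * qconj (quat_col a y k 0))) x =
    4 * ddphi (sqdist a x) * (x l j - a l j) * (-1 * (x k 1 - a k 1))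
    + 2 * dphi (sqdist a x) * (-1) * ((l == k) && (j == 1))%:R.
  by apply: P => y; rewrite /= mxE /=; ring.
have E2 j : partial l j
    (@q2 R \o (fun y => rq (2 * dphi (sqdist a y)) * qconj (quat_col a y k 0))) x =
    4 * ddphi (sqdist a x) * (x l j - a l j) * (-1 * (x k 2%:R - a k 2%:R))
    + 2 * dphi (sqdist a x) * (-1) * ((l == k) && (j == 2%:R))%:R.
  by apply: P => y; rewrite /= mxE /=; ring.
have E3 j : partial l j
    (@q3 R \o (fun y => rq (2 * dphi (sqdist a y)) * qconj (quat_col a y k 0))) x =
    4 * ddphi (sqdist a x) * (x l j - a l j) * (-1 * (x k 3%:R - a k 3%:R))
    + 2 * dphi (sqdist a x) * (-1) * ((l == k) && (j == 3%:R))%:R.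
  by apply: P => y; rewrite /= mxE /=; ring.
rewrite /d_dqbar /qpartial !mxE !E0 !E1 !E2 !E3 !andbF !andbT.
by case: (l == k); apply: quat_eq => /=; ring.
Qed.

End Hessian.

(** The inequality on dphi is the positivity of the eigenvalue of multiplicity
    n - 1 of the Hessian; given it, the next one is the positivity of the m-th
    elementary symmetric function of the eigenvalues. *)
Lemma smooth_qsh_radial (n m : nat) (D : set (Hn R n)) (a : Hn R n)
    (phi dphi ddphi : R -> R) :
  (1 <= m)%N -> (m <= n)%N ->
  (forall t : R, 0 <= t -> is_derive t (1 : R) phi (dphi t)) ->
  (forall t : R, 0 <= t -> is_derive t (1 : R) dphi (ddphi t)) ->
  smooth_on 2 phi ->
  (forall t : R, 0 <= t -> 0 < dphi t) ->
  (forall t : R, 0 <= t -> 0 < 2 * n%:R * dphi t + m%:R * t * ddphi t) ->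
  smooth_qsh m D (phi \o sqdist a).
Proof.
case: m => // m _; case: n D a => // n D a mn h1 h2 sphi pos1 pos2; split.
  exact/Ck_setT/Ck_radial.
move=> x _; apply: subset_closure; rewrite (quat_hessian_radial _ _ h1 h2).
apply: rank_one_Gamma => //; first by rewrite mulr_gt0 ?pos1 ?sqdist_ge0.
rewrite /vnorm2 -sqdist_qnorm2.
by have := pos2 _ (sqdist_ge0 a x); lra.
Qed.

End HessianRadial.

(** * Smooth functions of one variable *)

Section SmoothOneVar.
Context {R : realType}.
Implicit Types (phi psi : R -> R) (t x : R).

Lemma smooth_onS k phi : smooth_on k.+1 phi -> smooth_on k phi.
Proof.
elim: k phi => [|k IH] phi sphi; first by move=> t; exact: smooth_on_continuous sphi.
by case: sphi => dphi h sdphi; exists dphi => //; exact: IH.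
Qed.

Lemma smooth_on_cst k (c : R) : smooth_on k (fun=> c).
Proof.
elim: k c => [|k IH] c; first by move=> t _; exact: cst_continuous.
by exists (fun=> 0) => // t _; exact: is_derive_cst.
Qed.

Lemma smooth_onD k phi psi :
  smooth_on k phi -> smooth_on k psi -> smooth_on k (phi \+ psi).
Proof.
elim: k phi psi => [|k IH] phi psi /=.
  by move=> h1 h2 t t0; apply: continuousD; [exact: h1|exact: h2].
move=> [dphi h1 s1] [dpsi h2 s2]; exists (dphi \+ dpsi); last exact: IH.
by move=> t t0; apply: is_deriveD; [exact: h1|exact: h2].
Qed.

Lemma smooth_onM k phi psi :
  smooth_on k phi -> smooth_on k psi -> smooth_on k (phi \* psi).
Proof.
elim: k phi psi => [|k IH] phi psi.
  by move=> h1 h2 t t0; apply: continuousM; [exact: h1|exact: h2].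
move=> s1' s2'; have := smooth_onS s1'; have := smooth_onS s2'.
case: s1' s2' => [dphi h1 s1] [dpsi h2 s2] s2' s1'.
exists ((phi \* dpsi) \+ (psi \* dphi)).
  move=> t t0; have := h1 t t0; have := h2 t t0 => d2 d1.
  exact: is_deriveM.
by apply: smooth_onD; apply: IH.
Qed.

Lemma smooth_onZ k (c : R) phi : smooth_on k phi -> smooth_on k (fun t => c * phi t).
Proof. by move=> s; apply: (@smooth_onM k (fun=> c)) => //; exact: smooth_on_cst. Qed.

Lemma smooth_onX k (j : nat) phi :
  smooth_on k phi -> smooth_on k (fun t => phi t ^+ j).
Proof.
move=> s; elim: j => [|j IH]; first exact: smooth_on_cst.
rewrite (_ : (fun t => _) = phi \* (fun t => phi t ^+ j)); first exact: smooth_onM.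
by apply/funext => t; rewrite exprS.
Qed.

Lemma is_derive_shift_power (e c t : R) : 0 < e -> 0 <= t ->
  is_derive t (1 : R) (fun t => (t + e) `^ c) (c * (t + e) `^ (c - 1)).
Proof.
move=> e0 t0; have te : 0 < t + e by rewrite ltr_wpDl.
have h1 := is_derive1_powR c te.
have h2 : is_derive t (1 : R) (fun t => t + e) 1.
  by apply: is_derive_eq; rewrite addr0.
have := @is_derive1_comp R (fun y : R => y `^ c) (fun y : R => y + e) t _ _ h1 h2.
by rewrite mulr1.
Qed.

Lemma smooth_on_power k (e c : R) : 0 < e ->
  smooth_on k (fun t => (t + e) `^ c).
Proof.
move=> e0; elim: k c => [|k IH] c.
  by move=> t t0; exact: is_derive_continuous (is_derive_shift_power c e0 t0).
exists (fun t => c * (t + e) `^ (c - 1)) => [t t0|].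
  exact: is_derive_shift_power.
exact: smooth_onZ.
Qed.

(** The functions x ^- j * exp (- 1 / x), extended by 0 to x <= 0; the family is
    stable under derivation up to linear combinations. *)
Definition flat (j : nat) x : R := if 0 < x then x ^- j * expR (- x^-1) else 0.

Lemma flat_ge0 j x : 0 <= flat j x.
Proof.
rewrite /flat; case: ifP => // x0.
by rewrite mulr_ge0 ?expR_ge0// invr_ge0 exprn_ge0// ltW.
Qed.

Lemma flat_gt0 j x : 0 < x -> 0 < flat j x.
Proof. by move=> x0; rewrite /flat x0 mulr_gt0 ?expR_gt0// invr_gt0 exprn_gt0. Qed.

Lemma flat_npos j x : x <= 0 -> flat j x = 0.
Proof. by rewrite /flat leNgt => /negbTE ->. Qed.

(** From y ^ (j+2) / (j+2)! <= exp y, at y = 1 / x. *)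
Lemma flat_bound j x : flat j x <= (j.+2)`!%:R * x ^+ 2.
Proof.
rewrite /flat; case: ifP => x0; last by rewrite mulr_ge0 ?sqr_ge0.
have xn0 : x != 0 by rewrite gt_eqF.
have := @expR_ge1Dxn R x^-1 j.+1; rewrite invr_ge0 (ltW x0) => /(_ isT).
move=> /(le_trans _) h.
have {h} : x^-1 ^+ j.+2 / (j.+2)`!%:R <= expR x^-1 by apply: h; rewrite lerDr.
rewrite ler_pdivrMr ?ltr0n ?fact_gt0// => h.
rewrite expRN -(@ler_pM2r _ (expR x^-1)) ?expR_gt0// mulfVK ?gt_eqF ?expR_gt0//.
rewrite -(@ler_pM2r _ (x^-1 ^+ 2)) ?exprn_gt0 ?invr_gt0//.
rewrite -exprVn -exprD addn2 (le_trans h)//.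
rewrite [leRHS](_ : _ = expR x^-1 * (j.+2)`!%:R)//.
by move: (expR _) (_ `!%:R) => u v; field.
Qed.

Lemma is_derive_flat j x :
  is_derive x (1 : R) (flat j) (flat j.+2 x - j%:R * flat j.+1 x).
Proof.
have [x0|x0|<-] := ltgtP 0 x.
- have xn0 : x != 0 by rewrite gt_eqF.
  have hV : is_derive x (1 : R) (fun y : R => y^-1) (- x^-1 ^+ 2).
    apply: is_derive_eq; first exact: is_deriveV.
    by rewrite [_%:A]mulr1 exprVn.
  have hE : is_derive x (1 : R) (fun y : R => expR (- y^-1)) (expR (- x^-1) * x^-1 ^+ 2).
    have hN : is_derive x (1 : R) (fun y : R => - y^-1) (x^-1 ^+ 2).
      by apply: is_derive_eq; rewrite opprK.
    exact: (@is_derive1_comp R expR (fun y : R => - y^-1) x _ _ _ hN).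
  have hX : is_derive x (1 : R) (fun y : R => y^-1 ^+ j) (- (j%:R * x^-1 ^+ j.+1)).
    rewrite (_ : (fun y : R => y^-1 ^+ j) = (fun y : R => y^-1) ^+ j); last first.
      by apply/funext => y; rewrite exprfctE.
    apply: is_derive_eq.
    case: (j) => [|i]; first by rewrite !mul0r scale0r oppr0.
    by rewrite /GRing.scale/= !exprS; ring.
  apply: (@near_eq_is_derive _ _ _ ((fun y : R => y^-1 ^+ j) * (fun y : R => expR (- y^-1)))).
    near=> y; rewrite /flat ifT; first by rewrite -exprVn.
    by near: y; exact: lt_nbhsr.
  apply: is_derive_eq.
  by rewrite /flat x0 /GRing.scale/= -!exprVn !exprS; ring.
- rewrite !flat_npos ?ltW// mulr0 subr0.
  have h0 : is_derive x (1 : R) (cst 0 : R -> R) 0 by exact: is_derive_cst.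
  apply: near_eq_is_derive h0.
  near=> y; rewrite /flat ifF//; apply/negbTE; rewrite -leNgt ltW//.
  by near: y; exact: lt_nbhsl.
rewrite !flat_npos// mulr0 subr0.
have h : (fun h : R => h^-1 *: ((flat j \o shift 0) (h *: (1 : R)) - flat j 0)) @ 0^' --> (0 : R).
  have C0 : 0 < (j.+2)`!%:R :> R by rewrite ltr0n fact_gt0.
  apply/cvgr0Pnorm_lt => e e0; near=> h.
  have h0 : h != 0 by near: h; exact: nbhs_dnbhs_neq.
  rewrite /= addr0 (flat_npos j (lexx 0)) subr0 [h *: 1]mulr1 normrM normfV ger0_norm ?flat_ge0//.
  rewrite (le_lt_trans (_ : _ <= `|h|^-1 * ((j.+2)`!%:R * h ^+ 2)))//.
    by rewrite ler_wpM2l ?invr_ge0//; exact: flat_bound.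
  rewrite -(real_normK (num_real h)) [X in X < _](_ : _ = (j.+2)`!%:R * `|h|); last first.
    by field; rewrite normr_eq0.
  rewrite -ltr_pdivlMl//; near: h; apply: dnbhs0_lt.
  by rewrite mulr_gt0// invr_gt0.
split; first by apply/cvg_ex; exists 0.
exact/cvg_lim.
Unshelve. all: by end_near. Qed.

Lemma smooth_on_flat k j (c d : R) : smooth_on k (fun t => flat j (c * t + d)).
Proof.
have hd i t : is_derive t (1 : R) (fun t => flat i (c * t + d))
    ((flat i.+2 (c * t + d) - i%:R * flat i.+1 (c * t + d)) * c).
  have h2 : is_derive t (1 : R) (fun t => c * t + d) c.
    by apply: is_derive_eq; rewrite ?scaler0 ?add0r ?addr0 [LHS]mulr1.
  exact: (@is_derive1_comp R (flat i) (fun t => c * t + d) t _ _ (is_derive_flat i _) h2).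
elim: k j => [|k IH] j.
  by move=> t t0; exact: is_derive_continuous (hd j t).
exists (fun t => (flat j.+2 (c * t + d) - j%:R * flat j.+1 (c * t + d)) * c) => //.
apply: (@smooth_onM k _ (fun=> c)); last exact: smooth_on_cst.
apply: (@smooth_onD k _ (fun t => - (j%:R * flat j.+1 (c * t + d)))) => //.
rewrite (_ : (fun t => _) = (fun t => (- j%:R) * flat j.+1 (c * t + d))).
  exact: smooth_onZ.
by apply/funext => t; rewrite mulNr.
Qed.

End SmoothOneVar.

Section Transition.
Context {R : realType}.
Implicit Types (F f kappa : R -> R) (t x y p q : R).

(** The primitive starts at -1, so as to be differentiable at 0 as well. *)
Lemma antiderivative f : continuous f ->
  exists F, forall t, 0 <= t -> is_derive t (1 : R) F (f t).
Proof.
move=> cf; exists (fun y => (\int[lebesgue_measure]_(t in [set` `[(-1 : R), y]]) (f t))%R).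
move=> t t0.
have fi : (@lebesgue_measure R).-integrable `[(-1 : R), t + 1] (EFin \o f).
  apply: continuous_compact_integrable; first exact: segment_compact.
  exact: continuous_subspaceT.
have [] := continuous_FTC1_closed (_ : t < t + 1) fi (_ : -1 < t) (cf t).
- by rewrite ltrDl.
- by rewrite (lt_le_trans _ t0)// ltrN10.
rewrite derive1E => d1 d2; exact: (DeriveDef d1 d2).
Qed.

Lemma mean_value F f x y :
  (forall t, 0 <= t -> is_derive t (1 : R) F (f t)) -> 0 <= x -> x <= y ->
  exists2 c, x <= c <= y & F y - F x = f c * (y - x).
Proof.
move=> h x0 xy.
have [||c cxy E] := @MVT_segment _ F f x y xy.
- by move=> c /[!in_itv]/= /andP[xc _]; apply: h; rewrite (le_trans x0)// ltW.
- apply: continuous_in_subspaceT => c /[!inE]/= /[!in_itv]/= /andP[xc _].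
  by apply: (is_derive_continuous (h c _)); rewrite (le_trans x0).
by exists c => //; move: cxy; rewrite in_itv.
Qed.

Lemma continuous_flat j : continuous (@flat R j).
Proof. by move=> t; exact: is_derive_continuous (is_derive_flat j t). Qed.

(** A smooth bump, positive exactly on ]p, q[. *)
Definition bump p q t : R := flat 0 (1 * t + - p) * flat 0 (-1 * t + q).

Lemma smooth_on_bump k p q : smooth_on k (bump p q).
Proof. by apply: (@smooth_onM R k); exact: smooth_on_flat. Qed.

Lemma continuous_bump p q : continuous (bump p q).
Proof.
have ha (c d : R) : continuous (fun t => flat 0 (c * t + d)).
  move=> t; apply: (@continuous_comp _ _ _ (fun t => c * t + d) (flat 0)).
    2: exact: continuous_flat.
  apply: continuousD; last exact: cst_continuous.
  by apply: continuousM; [exact: cst_continuous|exact: cvg_id].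
by move=> t; exact: (continuousM (ha 1 (- p) t) (ha (-1) q t)).
Qed.

Lemma bump_ge0 p q t : 0 <= bump p q t.
Proof. by rewrite /bump mulr_ge0 ?flat_ge0. Qed.

Lemma bump_gt0 p q t : p < t < q -> 0 < bump p q t.
Proof. by move=> /andP[pt tq]; rewrite /bump mulr_gt0// flat_gt0//; lra. Qed.

Lemma bump_le p q t : t <= p -> bump p q t = 0.
Proof. by move=> tp; rewrite /bump flat_npos ?mul0r//; lra. Qed.

Lemma bump_ge p q t : q <= t -> bump p q t = 0.
Proof. by move=> tp; rewrite /bump [X in _ * X]flat_npos ?mulr0//; lra. Qed.

(** A smooth transition X from 1 on [0, p] to 0 on [q, oo[, together with the
    primitive K of kappa X' that vanishes at q; as kappa is nonincreasing, K lies
    between kappa q * X and kappa p * X. *)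
Lemma transition kappa p q :
  (forall k, smooth_on k kappa) ->
  (forall t, 0 <= t -> 0 <= kappa t) ->
  (forall t s, 0 <= t -> t <= s -> kappa s <= kappa t) ->
  0 < p -> p < q ->
  exists X dX K : R -> R,
    [/\ forall t, 0 <= t -> is_derive t (1 : R) X (dX t),
        forall t, 0 <= t -> is_derive t (1 : R) K (kappa t * dX t),
        forall k, smooth_on k dX &
        [/\ forall t, 0 <= t -> 0 <= X t <= 1,
            forall t, 0 <= t -> t <= p -> X t = 1,
            forall t, q <= t -> X t = 0 &
            forall t, 0 <= t -> kappa q * X t <= K t <= kappa p * X t]].
Proof.
move=> skappa kappa0 kappa_dec p0 pq.
have q0 : 0 < q by exact: lt_trans pq.
pose b := bump p q.
have [B hB] := antiderivative (@continuous_bump p q).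
(* The argument of kappa is max(t, 0), since kappa is controlled on t >= 0 only. *)
pose kb t := kappa ((t + `|t|) / 2) * b t.
have ckb : continuous kb.
  move=> t; have t0 : 0 <= (t + `|t|) / 2.
    by rewrite divr_ge0// -lerBlDl sub0r -normrN ler_norm.
  have h1 : {for t, continuous (fun t => (t + `|t|) / 2)}.
    apply: continuousM; last exact: cst_continuous.
    by apply: continuousD; [exact: cvg_id|exact: norm_continuous].
  have h2 := @continuous_comp _ _ _ _ kappa t h1 (smooth_on_continuous (skappa 0%N) t0).
  exact: (continuousM h2 (@continuous_bump p q t)).
have [K0 hK0'] := antiderivative ckb.
have hK0 t : 0 <= t -> is_derive t (1 : R) K0 (kappa t * b t).
  move=> t0; have := hK0' t t0; rewrite /kb ger0_norm//.
  by rewrite (_ : (t + t) / 2 = t)//; field.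
have Bpq : 0 < B q - B p.
  have [c + ->] : exists2 c, p < c < q & B q - B p = b c * (q - p).
    have [||c cpq E] := @MVT R B b p q pq.
    - by move=> c /[!in_itv]/= /andP[pc _]; apply: hB; rewrite ltW// (lt_trans p0).
    - apply: continuous_in_subspaceT => c /[!inE]/= /[!in_itv]/= /andP[pc _].
      by apply: (is_derive_continuous (hB c _)); rewrite (le_trans (ltW p0)).
    by exists c => //; move: cpq; rewrite in_itv.
  by move=> cpq; rewrite mulr_gt0 ?bump_gt0// subr_gt0.
have Bmon x y : 0 <= x -> x <= y -> B x <= B y.
  move=> x0 xy; have [c _ E] := mean_value hB x0 xy.
  by rewrite -subr_ge0 E mulr_ge0 ?bump_ge0// subr_ge0.
have Bp t : 0 <= t -> t <= p -> B t = B p.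
  move=> t0 tp; have [c /andP[_ cp] E] := mean_value hB t0 tp.
  by apply/eqP; rewrite eq_sym -subr_eq0 E bump_le// mul0r.
have Bq t : q <= t -> B t = B q.
  move=> qt; have [c /andP[qc _] E] := mean_value hB (ltW q0) qt.
  by apply/eqP; rewrite -subr_eq0 E bump_ge// mul0r.
have Kq t : q <= t -> K0 t = K0 q.
  move=> qt; have [c /andP[qc _] E] := mean_value hK0 (ltW q0) qt.
  by apply/eqP; rewrite -subr_eq0 E /b bump_ge// mulr0 mul0r.
pose c := (B q - B p)^-1.
have c0 : 0 < c by rewrite invr_gt0.
have hlin F f (d : R) : (forall t, 0 <= t -> is_derive t (1 : R) F (f t)) ->
    forall t, 0 <= t -> is_derive t (1 : R) (fun t => c * (d - F t)) (- c * f t).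
  move=> h t t0; have ht := h t t0.
  have -> : (fun t => c * (d - F t)) = cst c * (cst d - F) by [].
  by apply: is_derive_eq; rewrite scaler0 addr0 sub0r /GRing.scale/= mulrN mulNr.
exists (fun t => c * (B q - B t)), (fun t => - c * b t), (fun t => c * (K0 q - K0 t)).
split; first exact: hlin.
- move=> t t0; rewrite mulrCA; exact: (hlin _ _ _ hK0).
- by move=> k; apply: smooth_onZ; exact: smooth_on_bump.
split.
- move=> t t0; apply/andP; split.
    rewrite mulr_ge0 ?(ltW c0)// subr_ge0.
    by have [tq|/ltW qt] := leP t q; [exact: Bmon|rewrite (Bq t)].
  rewrite /c ler_pdivrMl// mulr1 lerB//.
  by have [tp|/ltW pt] := leP t p; [rewrite (Bp t)|apply: Bmon => //; exact: ltW].
- by move=> t t0 tp; rewrite (Bp t)// /c mulVf ?gt_eqF.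
- by move=> t qt; rewrite (Bq t)// subrr mulr0.
move=> t t0; rewrite !(mulrCA _ c) !ler_pM2l//.
have [tq|/ltW qt] := leP t q; last by rewrite (Kq t)// (Bq t)// !subrr !mulr0 lexx.
apply/andP; split.
  have h (s : R) : 0 <= s ->
      is_derive s (1 : R) (K0 - cst (kappa q) * B) (kappa s * b s - kappa q * b s).
    move=> s0; have h1 := hK0 s s0; have h2 := hB s s0.
    by apply: is_derive_eq; rewrite scaler0 addr0.
  have [s /andP[ts sq] E] := mean_value h t0 tq.
  have : 0 <= (K0 - cst (kappa q) * B) q - (K0 - cst (kappa q) * B) t.
    rewrite E -mulrBl mulr_ge0 ?subr_ge0// mulr_ge0 ?bump_ge0// subr_ge0.
    by apply: kappa_dec => //; exact: le_trans ts.
  rewrite -[X in 0 <= X]/(K0 q - kappa q * B q - (K0 t - kappa q * B t)).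
  by rewrite mulrBr; lra.
have h (s : R) : 0 <= s ->
    is_derive s (1 : R) (cst (kappa p) * B - K0) (kappa p * b s - kappa s * b s).
  move=> s0; have h1 := hK0 s s0; have h2 := hB s s0.
  by apply: is_derive_eq; rewrite scaler0 addr0.
have [s /andP[ts sq] E] := mean_value h t0 tq.
have : 0 <= (cst (kappa p) * B - K0) q - (cst (kappa p) * B - K0) t.
  rewrite E -mulrBl mulr_ge0 ?subr_ge0//.
  have [sp|/ltW ps] := leP s p; first by rewrite /b bump_le// mulr0.
  by rewrite mulr_ge0 ?bump_ge0// subr_ge0; apply: kappa_dec => //; exact: ltW.
rewrite -[X in 0 <= X]/(kappa p * B q - K0 q - (kappa p * B t - K0 t)).
by rewrite mulrBr; lra.
Qed.

End Transition.

(** * Balls and the Borel sigma-algebra *)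

Section Balls.
Context {R : realType} {n : nat}.
Local Notation Hn := (Hn R n).
Implicit Types (a x : Hn) (c r s : R).

(** The ball of squared radius c; it is empty when c <= 0. *)
Definition sqball a c : set Hn := [set x | sqdist a x < c].

Lemma eball_sqball a r : 0 < r -> eball a r = sqball a (r ^+ 2).
Proof.
move=> r0; apply/seteqP; split=> x; rewrite /eball /sqball /= /enorm.
  move=> h; rewrite /sqdist.
  have S0 : 0 <= \sum_l \sum_j (x - a) l j ^+ 2.
    by apply: sumr_ge0 => l _; apply: sumr_ge0 => j _; exact: sqr_ge0.
  move: h; rewrite -ltr_sqr ?nnegrE ?sqrtr_ge0 ?ltW// sqr_sqrtr//.
  congr (_ < _); apply: eq_bigr => l _; apply: eq_bigr => j _.
  by rewrite !mxE.
move=> h.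
have S0 : 0 <= \sum_l \sum_j (x - a) l j ^+ 2.
  by apply: sumr_ge0 => l _; apply: sumr_ge0 => j _; exact: sqr_ge0.
rewrite -ltr_sqr ?nnegrE ?sqrtr_ge0 ?ltW// sqr_sqrtr//.
move: h; congr (_ < _); apply: eq_bigr => l _; apply: eq_bigr => j _.
by rewrite !mxE.
Qed.

Lemma sqball_mono a c d : c <= d -> sqball a c `<=` sqball a d.
Proof. by move=> cd x xc; exact: lt_le_trans cd. Qed.

Lemma open_sqball a c : open (sqball a c).
Proof.
rewrite (_ : sqball a c = sqdist a @^-1` `]-oo, c[%classic).
  by apply: open_comp; [move=> x _; exact: continuous_sqdist|exact: interval_open].
by apply/seteqP; split=> x /=; rewrite /sqball /= in_itv.
Qed.

Lemma closed_sqball a c : closed [set x | sqdist a x <= c].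
Proof.
rewrite (_ : [set x | _] = sqdist a @^-1` `]-oo, c]%classic).
  by apply: closed_comp; [move=> x _; exact: continuous_sqdist|exact: interval_closed].
by apply/seteqP; split=> x /=; rewrite in_itv.
Qed.

Lemma measurable_open (U : set Hn) : open U -> measurable (U : set (borel R n)).
Proof. by move=> oU; apply: sub_sigma_algebra. Qed.

Lemma measurable_continuous (f : Hn -> R) : continuous f ->
  measurable_fun [set: borel R n] (f : borel R n -> R).
Proof.
move=> cf; apply: (measurability _ (measurable_realfun.RGenOpens.measurableE R)).
move=> _ [_ [x [y ->]] <-]; rewrite setTI.
apply: measurable_open; apply: open_comp; last exact: interval_open.
by move=> z _; exact: cf.
Qed.

End Balls.

Section Exponents.
Context {R : realType}.

Lemma lelong_exponent (n m : nat) (r : R) : (0 < m)%N -> 0 < r ->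
  (r `^ ((4 * n * (m - 1))%:R / m%:R))^-1 =
  ((r ^+ 2) `^ (- ((2 * n)%:R / m%:R))) ^+ (m - 1).
Proof.
move=> m0 r0.
rewrite -(powR_mulrn _ (powR_ge0 _ _)) -(powR_mulrn _ (ltW r0)) -!powRrM -powRN.
congr (_ `^ _); rewrite !natrM; field.
by rewrite pnatr_eq0 -lt0n.
Qed.

End Exponents.

(** * Monotonicity of the mass ratio *)

Section Monotonicity.
Context {R : realType} {n m : nat}.
Local Notation Hn := (Hn R n).
Implicit Types (x : Hn) (e t : R).
Variables (D : set Hn) (a : Hn) (rho : R) (u : Hn -> \bar R).
Variable mu : {measure set (borel R n) -> \bar R}.
Hypotheses (hm1 : (1 <= m)%N) (hmn : (m <= n)%N) (hDopen : open D) (hrho : 0 < rho).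
Hypothesis hball_compact : compact (closure (eball a rho)).
Hypothesis hball_sub : closure (eball a rho) `<=` D.
Hypothesis hu : QSH m D u.
Hypothesis hmu : is_Delta_beta_measure D u mu.

Lemma compact_sqball c : c < rho ^+ 2 -> compact [set x | sqdist a x <= c].
Proof.
move=> crho; apply: subclosed_compact hball_compact _; first exact: closed_sqball.
apply: subset_trans (@subset_closure _ _); rewrite eball_sqball//.
by move=> x /= /le_lt_trans; apply.
Qed.

Lemma sub_sqball c : c < rho ^+ 2 -> [set x | sqdist a x <= c] `<=` D.
Proof.
move=> crho; apply: subset_trans hball_sub.
apply: subset_trans (@subset_closure _ _); rewrite eball_sqball//.
by move=> x /= /le_lt_trans; apply.
Qed.

Lemma mu_sqball_lty c : c < rho ^+ 2 -> (mu (sqball a c) < +oo)%E.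
Proof.
move=> crho; have [_ fin _] := hmu.
apply: le_lt_trans (fin _ (compact_sqball crho) (sub_sqball crho)).
apply: le_measure; rewrite ?inE.
- by apply: measurable_open; exact: open_sqball.
- rewrite -[X in measurable X]setCK; apply: measurableC.
  by apply: measurable_open; apply: closed_openC; exact: closed_sqball.
- by move=> x /ltW.
Qed.

Lemma test_function_radial c (phi : R -> R) : c < rho ^+ 2 ->
  (forall k, smooth_on k phi) -> (forall t, c <= t -> phi t = 0) ->
  test_function D (phi \o sqdist a).
Proof.
move=> crho sphi phi0.
have S : closure [set x | (phi \o sqdist a) x != 0] `<=` [set x | sqdist a x <= c].
  rewrite [X in _ `<=` X](closure_id _).1; last exact: closed_sqball.
  apply: closure_subset => x /=; apply: contra_neqT; rewrite -ltNge => /ltW.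
  exact: phi0.
split.
- by move=> k; exact: Ck_radial.
- apply: subclosed_compact (compact_sqball crho) S.
  exact: closed_closure.
- exact: subset_trans S (sub_sqball crho).
Qed.

(** The function (t + e) ^ (- (m - 1) 2n / m); at e = 0 and t = r^2 it is the factor
    1 / r ^ (4n (m - 1) / m). *)
Definition weight e t : R := ((t + e) `^ (- ((2 * n)%:R / m%:R))) ^+ (m - 1).

(** The definition of QSH_m is used once, with all the v_i equal to phi o P where
    8 phi'(t) = (t + e)^(-2n/m), and with w = psi o P. *)
Lemma radial_pairing_ge0 e c (psi dpsi chi : R -> R) : 0 < e -> c < rho ^+ 2 ->
  (forall t, 0 <= t -> is_derive t (1 : R) psi (dpsi t)) ->
  (forall t, 0 <= t -> is_derive t (1 : R) chi (weight e t * dpsi t)) ->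
  (forall k, smooth_on k dpsi) ->
  (forall t, c <= t -> psi t = 0) -> (forall t, c <= t -> chi t = 0) ->
  (forall t, 0 <= t -> 0 <= psi t) ->
  0 <= (\int[mu]_(x in D) (chi \o sqdist a) x)%R.
Proof.
move=> e0 crho hpsi hchi sdpsi psi0 chi0 psi_ge0.
pose p : R := (2 * n)%:R / m%:R.
have m0 : m%:R != 0 :> R by rewrite pnatr_eq0 -lt0n.
have n0 : 0 < n%:R :> R by rewrite ltr0n (leq_trans hm1).
have mp : m%:R * p = 2 * n%:R by rewrite /p natrM; field.
(* p >= 2 because m <= n; so 1 - p != 0, and phi' has a power as primitive. *)
have p2 : 2 <= p.
  by rewrite /p ler_pdivlMr ?ltr0n// natrM ler_pM2l// ler_nat.
have p1 : 1 - p != 0 by rewrite subr_eq0 lt_eqF// (lt_le_trans _ p2)// ltr1n.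
pose phi t : R := (8 * (1 - p))^-1 * (t + e) `^ (1 - p).
pose dphi t : R := 8^-1 * (t + e) `^ (- p).
pose ddphi t : R := 8^-1 * (- p * (t + e) `^ (- p - 1)).
have hphi t : 0 <= t -> is_derive t (1 : R) phi (dphi t).
  move=> t0; have h := is_derive_shift_power (1 - p) e0 t0.
  have -> : phi = cst (8 * (1 - p))^-1 * (fun t => (t + e) `^ (1 - p)) by [].
  apply: is_derive_eq; rewrite scaler0 addr0 /dphi /GRing.scale/=.
  rewrite (_ : 1 - p - 1 = - p); last by ring.
  by field.
have hdphi t : 0 <= t -> is_derive t (1 : R) dphi (ddphi t).
  move=> t0; have h := is_derive_shift_power (- p) e0 t0.
  have -> : dphi = cst 8^-1 * (fun t => (t + e) `^ (- p)) by [].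
  by apply: is_derive_eq; rewrite scaler0 addr0.
have sphi k : smooth_on k phi by apply: smooth_onZ; exact: smooth_on_power.
have weightE t : weight e t = (8 * dphi t) ^+ (m - 1).
  by rewrite /dphi mulrA mulfV ?mul1r.
have [ddpsi hdpsi _] := sdpsi 1%N.
have hweight t : 0 <= t -> is_derive t (1 : R) (weight e)
    ((m - 1)%:R * (8 * dphi t) ^+ (m - 1).-1 * (8 * ddphi t)).
  move=> t0; have h := hdphi t t0.
  have -> : weight e = (cst 8 * dphi) ^+ (m - 1).
    by apply/funext => s; rewrite exprfctE weightE.
  by apply: is_derive_eq; rewrite scaler0 addr0.
have hdchi t : 0 <= t -> is_derive t (1 : R) (fun t => weight e t * dpsi t)
    ((8 * dphi t) ^+ (m - 1) * ddpsi t +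
     (m - 1)%:R * (8 * dphi t) ^+ (m - 1).-1 * (8 * ddphi t) * dpsi t).
  move=> t0; have h1 := hweight t t0; have h2 := hdpsi t t0.
  have -> : (fun t => weight e t * dpsi t) = weight e * dpsi by [].
  by apply: is_derive_eq; rewrite weightE /GRing.scale/= (mulrC (dpsi t)).
have spsi k : smooth_on k psi.
  by case: k => [|k]; [move=> t t0; exact: is_derive_continuous (hpsi t t0)|exists dpsi].
have sweight k : smooth_on k (weight e).
  by apply: smooth_onX; exact: smooth_on_power.
have schi k : smooth_on k chi.
  case: k => [|k]; first by move=> t t0; exact: is_derive_continuous (hchi t t0).
  by exists (fun t => weight e t * dpsi t) => //; exact: smooth_onM.
have qshphi : smooth_qsh m D (phi \o sqdist a).
  apply: smooth_qsh_radial hphi hdphi (sphi 2%N) _ _ => // t t0.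
    by rewrite /dphi mulr_gt0 ?powR_gt0 ?ltr_wpDl.
  have te : 0 < t + e by rewrite ltr_wpDl.
  have -> : 2 * n%:R * dphi t + m%:R * t * ddphi t =
      8^-1 * (t + e) `^ (- p - 1) * (2 * n%:R * e).
    rewrite /dphi /ddphi.
    have -> : (t + e) `^ (- p) = (t + e) `^ (- p - 1) * (t + e).
      rewrite -[X in _ * X](powRr1 (ltW te)) -powRD; last by rewrite (gt_eqF te) implybT.
      by rewrite subrK.
    have -> : 2 * n%:R = m%:R * p by [].
    by ring.
  by rewrite !mulr_gt0// powR_gt0.
have [_ _ _ pos] := hu.
have [_ _ meas] := hmu.
have := meas _ (test_function_radial crho schi chi0).
have := pos (fun=> phi \o sqdist a) (psi \o sqdist a) _
  (test_function_radial crho spsi psi0).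
move=> h E.
have {}h : 0 <= form_integral D u (fun x =>
    wedge (wedge_pow beta_n (n - 1)) (Delta (chi \o sqdist a) x)).
  rewrite [X in form_integral D u X](_ : _ = (fun x =>
     wedge (\big[wedge/one_form]_(i < m - 1) Delta (phi \o sqdist a) x)
     (wedge (wedge_pow beta_n (n - m)) (Delta (psi \o sqdist a) x)))).
    apply: h => [i|x]; last exact/psi_ge0/sqdist_ge0.
    by split=> //; apply: Ck_setT; exact: Ck_radial.
  apply/funext => x; rewrite (_ : n - 1 = (m - 1) + (n - m))%N; last by lia.
  apply/esym; apply: (radial_form_identity _ _ _ hphi hdphi hpsi hdpsi hchi hdchi) => // t t0.
  by rewrite weightE.
by move: h; rewrite -E lecR.
Qed.

Lemma weight_ge0 e t : 0 <= weight e t.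
Proof. by rewrite exprn_ge0// powR_ge0. Qed.

Lemma weight_decr e t s : 0 < e -> 0 <= t -> t <= s -> weight e s <= weight e t.
Proof.
move=> e0 t0 ts; have te : 0 < t + e by rewrite ltr_wpDl.
have se : 0 < s + e by rewrite (lt_le_trans te)// lerD2r.
apply: lerXn2r; rewrite ?nnegrE ?powR_ge0//.
rewrite !powRN lef_pV2 ?posrE ?powR_gt0//.
apply: ge0_ler_powR.
- by rewrite divr_ge0.
- by rewrite nnegrE ltW.
- by rewrite nnegrE ltW.
- by rewrite lerD2r.
Qed.

Lemma smooth_on_weight k e : 0 < e -> smooth_on k (weight e).
Proof. by move=> e0; apply: smooth_onX; exact: smooth_on_power. Qed.

(** The mass of the ball of squared radius c. *)
Definition mass c : R := fine (mu (sqball a c)).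

Lemma measurable_sqball c : measurable (sqball a c : set (borel R n)).
Proof. by apply: measurable_open; exact: open_sqball. Qed.

Lemma integrable_sqball c : c < rho ^+ 2 ->
  mu.-integrable (D : set (borel R n)) (EFin \o \1_(sqball a c : set (borel R n))).
Proof.
move=> crho; have mD : measurable (D : set (borel R n)) by exact: measurable_open.
have mS := measurable_sqball c.
apply/integrableP; split.
  by apply/measurable_realfun.measurable_EFinP; exact: measurable_realfun.measurable_indic.
under eq_integral => x _ do rewrite /= ger0_norm//.
rewrite integral_indic//; apply: le_lt_trans (mu_sqball_lty crho).
by apply: le_measure; rewrite ?inE//; exact: measurableI.
Qed.

Lemma Rintegral_sqball c : c < rho ^+ 2 ->
  (\int[mu]_(x in D) (\1_(sqball a c : set (borel R n)) x : R))%R = mass c.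
Proof.
move=> crho; have mD : measurable (D : set (borel R n)) by exact: measurable_open.
rewrite /Rintegral integral_indic//; last exact: measurable_sqball.
rewrite setIidl//; apply: subset_trans (sub_sqball crho).
by move=> x /ltW.
Qed.

(** Radii are squared. The inequality [radial_pairing_ge0] is applied to the
    difference of two transitions, on [s2 - d, s2] and on [r2 - d, r2], which is
    nonnegative because r2 <= s2 - d; the parameter e of the weight is d too, so
    that the right-hand side does not depend on d. *)
Lemma mass_inequality r2 s2 d : 0 < d -> d < r2 -> r2 + d < s2 -> s2 < rho ^+ 2 ->
  weight d r2 * mass (r2 - d) <= weight d (s2 - d) * mass s2.
Proof.
move=> d0 dr rs srho.
have mD : measurable (D : set (borel R n)) by exact: measurable_open.
have r0 : 0 < r2 - d by rewrite subr_gt0.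
have s0 : 0 < s2 - d by lra.
have rrho : r2 - d < rho ^+ 2 by lra.
have trans q := @transition R (weight d) (q - d) q (fun k => smooth_on_weight k d0)
  (fun t _ => weight_ge0 d t) (fun t s => @weight_decr d t s d0).
have [|X1 [dX1 [K1 [hX1 hK1 sX1 [X1b X1p X1q K1b]]]]] := trans r2 r0; first by lra.
have [|X2 [dX2 [K2 [hX2 hK2 sX2 [X2b X2p X2q K2b]]]]] := trans s2 s0; first by lra.
pose psi t := X2 t - X1 t; pose chi t := K2 t - K1 t.
have hpsi t : 0 <= t -> is_derive t (1 : R) psi (dX2 t - dX1 t).
  by move=> t0; have h1 := hX1 t t0; have h2 := hX2 t t0; exact: is_deriveB.
have hchi t : 0 <= t -> is_derive t (1 : R) chi (weight d t * (dX2 t - dX1 t)).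
  move=> t0; have h1 := hK1 t t0; have h2 := hK2 t t0.
  by rewrite mulrBr; exact: is_deriveB.
have spsi k : smooth_on k (fun t => dX2 t - dX1 t).
  apply: (@smooth_onD _ k dX2 (fun t => - dX1 t)) => //.
  rewrite (_ : (fun t => - dX1 t) = (fun t => -1 * dX1 t)); first exact: smooth_onZ.
  by apply/funext => t; rewrite mulN1r.
have K1q t : r2 <= t -> K1 t = 0.
  move=> rt; have t0 : 0 <= t by lra.
  by have := K1b t t0; rewrite X1q// !mulr0; lra.
have K2q t : s2 <= t -> K2 t = 0.
  move=> rt; have t0 : 0 <= t by lra.
  by have := K2b t t0; rewrite X2q// !mulr0; lra.
have psi0 t : s2 <= t -> psi t = 0 by move=> st; rewrite /psi X1q ?X2q ?subr0//; lra.
have chi0 t : s2 <= t -> chi t = 0 by move=> st; rewrite /chi K1q ?K2q ?subr0//; lra.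
have psi_ge0 t : 0 <= t -> 0 <= psi t.
  move=> t0; rewrite /psi subr_ge0; have [ts|st] := leP t (s2 - d).
    by rewrite (X2p t)//; have /andP[] := X1b t t0.
  by rewrite X1q; [have /andP[] := X2b t t0|lra].
have pos := radial_pairing_ge0 d0 srho hpsi hchi spsi psi0 chi0 psi_ge0.
pose A := weight d (s2 - d); pose C := weight d r2; pose A1 := weight d (r2 - d).
have A0 : 0 <= A := weight_ge0 d _.
have C0 : 0 <= C := weight_ge0 d _.
have A10 : 0 <= A1 := weight_ge0 d _.
pose one c : borel R n -> R := \1_(sqball a c : set (borel R n)).
have oneE c x : one c x = if sqdist a x < c then 1 else 0.
  rewrite /one indicE; case: ifPn => h; first by rewrite mem_set.
  by rewrite memNset//; exact/negP.
have K2ub x : K2 (sqdist a x) <= A * one s2 x.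
  have t0 := sqdist_ge0 a x.
  have /andP[_ h] := K2b _ t0; apply: (le_trans h); rewrite ler_wpM2l//.
  rewrite oneE; have [_|h'] := ltP (sqdist a x) s2; last by rewrite X2q.
  by have /andP[] := X2b _ t0.
have K1lb x : C * one (r2 - d) x <= K1 (sqdist a x).
  have t0 := sqdist_ge0 a x.
  have /andP[h _] := K1b _ t0; apply: le_trans h; rewrite ler_wpM2l//.
  rewrite oneE; have [h'|_] := ltP (sqdist a x) (r2 - d).
    by rewrite X1p// ltW.
  by have /andP[] := X1b _ t0.
have K1ub x : K1 (sqdist a x) <= A1 * one s2 x.
  have t0 := sqdist_ge0 a x.
  have /andP[_ h] := K1b _ t0; apply: (le_trans h); rewrite ler_wpM2l//.
  rewrite oneE; have [_|h'] := ltP (sqdist a x) s2; last by rewrite X1q//; lra.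
  by have /andP[] := X1b _ t0.
have K1ge0 x : 0 <= K1 (sqdist a x).
  by apply: le_trans (K1lb x); rewrite mulr_ge0// oneE; case: ifP.
have K2ge0 x : 0 <= K2 (sqdist a x).
  have t0 := sqdist_ge0 a x.
  have /andP[h _] := K2b _ t0; apply: le_trans h.
  by rewrite mulr_ge0 ?weight_ge0//; have /andP[] := X2b _ t0.
have ione c : c < rho ^+ 2 -> mu.-integrable (D : set (borel R n)) (EFin \o one c).
  exact: integrable_sqball.
have iZ (z c : R) : c < rho ^+ 2 ->
    mu.-integrable (D : set (borel R n)) (EFin \o (fun x => z * one c x)).
  by move=> crho; have := @integrableZl _ _ _ mu D mD z _ (ione c crho).
have ichi : mu.-integrable (D : set (borel R n)) (EFin \o (chi \o sqdist a)).
  apply: le_integrable (iZ (A + A1) s2 srho) => //.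
    apply/measurable_realfun.measurable_EFinP; apply: measurable_funS (measurable_continuous _) => //.
    move=> x; apply: continuous_comp; first exact: continuous_sqdist.
    exact: (is_derive_continuous (hchi _ (sqdist_ge0 a x))).
  move=> x _ /=; rewrite lee_fin (le_trans (ler_normB _ _))// !ger0_norm//.
    by rewrite mulrDl lerD.
  by rewrite mulr_ge0 ?addr_ge0// oneE; case: ifP.
have ib : mu.-integrable (D : set (borel R n))
    (EFin \o (fun x => A * one s2 x - C * one (r2 - d) x)).
  by apply: (integrableB mD (iZ A s2 srho) (iZ C (r2 - d) rrho)).
have := le_Rintegral mD ichi ib.
move=> /(_ (fun x _ => lerB (K2ub x) (K1lb x))) /(le_trans pos).
rewrite RintegralB//; [|exact: iZ|exact: iZ].
rewrite !RintegralZl//; [|exact: ione|exact: ione].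
by rewrite !Rintegral_sqball// subr_ge0.
Qed.

Lemma mass_cvg r2 (d : nat -> R) : r2 < rho ^+ 2 ->
  (forall k, 0 < d k) -> (forall i j, (i <= j)%N -> d j <= d i) ->
  d k @[k --> \oo] --> 0 ->
  mass (r2 - d k) @[k --> \oo] --> mass r2.
Proof.
move=> rrho d0 dd dcvg.
pose F k : set (borel R n) := sqball a (r2 - d k).
have FU : \bigcup_k F k = sqball a r2.
  apply/seteqP; split=> [x [k _]|x xr].
    by apply: sqball_mono; rewrite gerBl ltW.
  have : \forall k \near \oo, d k < r2 - sqdist a x.
    apply: (cvgr_lt 0) => //; by rewrite subr_gt0.
  case=> N _ /(_ N (leqnn N)) /= h; exists N => //.
  by rewrite /F /sqball /= ltrBrDl -ltrBrDr.
have mF k : measurable (F k) by exact: measurable_sqball.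
have := @nondecreasing_cvg_mu _ _ _ mu F mF.
rewrite FU => /(_ (measurable_sqball r2)) h.
have {}h : mu (F k) @[k --> \oo] --> mu (sqball a r2).
  apply: h => i j ij; apply/subsetPset; apply: sqball_mono.
  by rewrite lerB// dd.
apply: fine_cvg; rewrite /mass fineK//.
by rewrite ge0_fin_numE// mu_sqball_lty.
Qed.

Lemma mass_ratio_mono r2 s2 : 0 < r2 -> r2 < s2 -> s2 < rho ^+ 2 ->
  weight 0 r2 * mass r2 <= weight 0 s2 * mass s2.
Proof.
move=> r0 rs srho.
pose d0 : R := Num.min r2 (s2 - r2) / 2.
have min0 : 0 < Num.min r2 (s2 - r2) by rewrite lt_min r0 subr_gt0.
have d00 : 0 < d0 by rewrite divr_gt0.
have dmin : d0 < Num.min r2 (s2 - r2) by rewrite /d0; lra.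
pose d k : R := d0 * k.+1%:R^-1.
have dk0 k : 0 < d k by rewrite mulr_gt0 ?invr_gt0.
have dle k : d k <= d0 by rewrite ger_pMr// invf_le1 ?ltr0n// ler1n.
have dd i j : (i <= j)%N -> d j <= d i.
  by move=> ij; rewrite ler_pM2l// lef_pV2 ?posrE// ler_nat.
have dcvg : d k @[k --> \oo] --> 0.
  rewrite -[X in _ --> X](mulr0 d0); apply: cvgM; first exact: cvg_cst.
  exact: cvg_harmonic.
have hk k : weight 0 (r2 + d k) * mass (r2 - d k) <= weight 0 s2 * mass s2.
  have h1 : d k < r2 by rewrite (le_lt_trans (dle k))// (lt_le_trans dmin)// ge_min lexx.
  have h2 : d k < s2 - r2.
    by rewrite (le_lt_trans (dle k))// (lt_le_trans dmin)// ge_min lexx orbT.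
  have := @mass_inequality r2 s2 (d k) (dk0 k) h1 _ srho.
  rewrite /weight !addr0 subrK; apply; lra.
suff L : weight 0 (r2 + d k) * mass (r2 - d k) @[k --> \oo] --> weight 0 r2 * mass r2.
  apply: (ler_cvg_to L (cvg_cst (weight 0 s2 * mass s2))).
  by apply: nearW => k; exact: hk.
apply: cvgM; last by apply: mass_cvg => //; exact: lt_trans srho.
have c : {for r2 / 2, continuous (weight (r2 / 2))}.
  by apply: (@smooth_on_weight 0%N); [|apply: ltW]; rewrite divr_gt0.
(* The weight of parameter 0 at r2 + d is that of parameter r2 / 2 at r2 / 2 + d,
   which is known to be continuous. *)
have -> : weight 0 r2 = weight (r2 / 2) (r2 / 2).
  by rewrite /weight addr0; congr (_ `^ _ ^+ _); field.
rewrite (_ : (fun k => _) = weight (r2 / 2) \o (fun k => r2 / 2 + d k)); last first.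
  by apply/funext => k; rewrite /= /weight addr0; congr (_ `^ _ ^+ _); field.
apply: continuous_cvg; first exact: c.
rewrite -[X in _ --> X]addr0; apply: cvgD => //; exact: cvg_cst.
Qed.

Lemma lelong_ratioE r : 0 < r -> r < rho ->
  lelong_ratio m mu a r = (weight 0 (r ^+ 2) * mass (r ^+ 2))%:E.
Proof.
move=> r0 rrho; rewrite /lelong_ratio eball_sqball// lelong_exponent//.
rewrite EFinM muleC /mass fineK; first by rewrite /weight addr0.
by rewrite ge0_fin_numE// mu_sqball_lty// ltr_pXn2r// nnegrE ltW.
Qed.

Lemma lelong_ratio_mono r s : 0 < r -> r <= s -> s < rho ->
  (lelong_ratio m mu a r <= lelong_ratio m mu a s)%E.
Proof.
move=> r0; rewrite le_eqVlt => /predU1P[->//|rs] srho.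
have s0 := lt_trans r0 rs.
rewrite !lelong_ratioE//; last exact: lt_trans srho.
rewrite lee_fin; apply: mass_ratio_mono.
- by rewrite exprn_gt0.
- by rewrite ltr_pXn2r// nnegrE ltW.
- by rewrite ltr_pXn2r// nnegrE ltW.
Qed.

Lemma lelong_limit :
  exists2 v : R, lelong_ratio m mu a r @[r --> 0^'+] --> v%:E & 0 <= v.
Proof.
pose S := [set lelong_ratio m mu a x | x in [set` Interval (BRight (0 : R)) (BLeft rho)]].
have itvE (x : R) : x \in Interval (BRight (0 : R)) (BLeft rho) -> 0 < x /\ x < rho.
  by rewrite in_itv/= => /andP.
have S0 : (0 <= ereal_inf S)%E.
  apply: le_ereal_inf_tmp => _ [x /= /itvE[x0 xrho] <-].
  rewrite lelong_ratioE// lee_fin mulr_ge0 ?weight_ge0//.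
  by rewrite /mass fine_ge0.
have S1 : (ereal_inf S < +oo)%E.
  have h : 0 < rho / 2 < rho by have := hrho; lra.
  have /andP[h1 h2] := h.
  apply: (@le_lt_trans _ _ (lelong_ratio m mu a (rho / 2))).
    by apply: ereal_inf_lbound; exists (rho / 2) => //=; rewrite in_itv.
  by rewrite lelong_ratioE// ltry.
exists (fine (ereal_inf S)); last by rewrite fine_ge0.
rewrite fineK ?ge0_fin_numE//.
apply: nondecreasing_at_right_cvge; first by rewrite bnd_simp.
by move=> r s /itvE[r0 _] /itvE[_ srho] rs; exact: lelong_ratio_mono.
Qed.

End Monotonicity.

Theorem proposition8p2 (R : realType) (n m : nat) (D : set (Hn R n))
    (a : Hn R n) (rho : R) (u : Hn R n -> \bar R)
    (mu : {measure set (borel R n) -> \bar R})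
    (hm1 : (1 <= m)%N) (hmn : (m <= n)%N)
    (hDopen : open D) (hDconn : connected D)
    (ha : D a) (hrho : 0 < rho)
    (hball_compact : compact (closure (eball a rho)))
    (hball_sub : closure (eball a rho) `<=` D)
    (hu : QSH m D u)
    (hmu : is_Delta_beta_measure D u mu) :
  (forall r s : R, 0 < r -> r <= s -> s < rho ->
     (lelong_ratio m mu a r <= lelong_ratio m mu a s)%E) /\
  (exists2 v : R, lelong_ratio m mu a r @[r --> 0^'+] --> v%:E & 0 <= v).
Proof.
split=> [r s r0 rs srho|].
  by apply: (@lelong_ratio_mono R n m D a rho u mu).
by apply: (@lelong_limit R n m D a rho u mu).
Qed.
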